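(* Let $\Theta$ be a metric space and $\Psi:\Theta\times\mathbb{R}\to\mathbb{R}$ jointly measurable, Lipschitz in the second argument, and such that for every $x\in\mathbb{R}$ the map $\theta\mapsto\Psi(\theta,x)$ is continuous. Let $\omega$ be a random element of $\Theta$, $\Psi=\Psi(\omega,\cdot)$, $L(\Psi)$ its Lipschitz constant, and assume $\mathbb{E}\log L(\Psi)<0$ and $\mathbb{E}\log^+|\Psi(\omega,0)|<\infty$. Let $X$ be the stationary solution ($X\overset{d}{=}\Psi(X)$, $X$ independent of $\Psi$) with law $\nu$. Assume there is a random pair $(A,B)\in(0,\infty)\times\mathbb{R}$ (depending on $\omega$) such that almost surely $$Ax-B\le\Psi(x)\le Ax+B\qquad\text{for }x\in\operatorname{supp}\nu,$$ and that $\mathbb{E}\log A<0$, $\mathbb{E}A^\alpha=1$ for some $\alpha>0$, $\mathbb{E}[|B|^\alpha+A^\alpha\log^+A]<\infty$, and the law of $\log A$ is non-arithmetic. Under these hypotheses the limit $C_+=\lim_{t\to\infty}t^\alpha\mathbb{P}[X>t]$ exists. If the support of $\nu$ is unbounded at $+\infty$, then $C_+>0$.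
   Context: The law of $\log A$ is non-arithmetic if it is not supported on $c\mathbb{Z}$ for any $c>0$. ''Unbounded at $+\infty$'' means not bounded from above. *)

(* Defs.v *)
From HB Require Import structures.
From mathcomp Require Import all_boot all_order all_algebra.
From mathcomp Require Import all_classical all_reals all_analysis.
Set Implicit Arguments. Unset Strict Implicit. Unset Printing Implicit Defensive.
Import Order.TTheory GRing.Theory Num.Theory.
Import numFieldNormedType.Exports.
Local Open Scope classical_set_scope.
Local Open Scope ring_scope.

Notation borelT T :=
  (g_sigma_algebraType (@open T)).

Definition lnp {R : realType} (x : R) : R := if 1 < x then ln x else 0.

Definition eln {R : realType} (x : \bar R) : \bar R :=
  match x with
  | r%:E => if 0 < r then (ln r)%:E else -oo%E
  | +oo%E => +oo%E
  | -oo%E => -oo%E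
  end.

Definition lipconst {R : realType} (f : R -> R) : \bar R :=
  ereal_sup [set z | exists x y : R, x != y /\ z = (`|f x - f y| / `|x - y|)%:E].

Definition indep {dO d1 d2} {R : realType} {Om : measurableType dO}
  (P : probability Om R) {T1 : measurableType d1} {T2 : measurableType d2}
  (Y1 : Om -> T1) (Y2 : Om -> T2) : Prop :=
  forall (A : set T1) (B : set T2), measurable A -> measurable B ->
    P (Y1 @^-1` A `&` Y2 @^-1` B) = (P (Y1 @^-1` A) * P (Y2 @^-1` B))%E.

Definition law_support {dO} {R : realType} {Om : measurableType dO}
  (P : probability Om R) (X : Om -> R) : set R :=
  [set x | forall e : R, 0 < e -> (0 < P (X @^-1` ball x e))%E].

Definition arithmetic_law {dO} {R : realType} {Om : measurableType dO}
  (P : probability Om R) (Y : Om -> R) : Prop :=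
  exists c : R, 0 < c /\
    P [set w | exists k : int, Y w = k%:~R * c] = 1%E.

(* Main.v *)
Require Import Defs.
From HB Require Import structures.
From mathcomp Require Import all_boot all_order all_algebra.
From mathcomp Require Import all_classical all_reals all_analysis.
From mathcomp Require Import measurable_realfun ring lra.
Import Order.TTheory GRing.Theory Num.Theory.
Import numFieldNormedType.Exports.
Local Open Scope classical_set_scope.
Local Open Scope ring_scope.

(* With T = A^alpha one has E T = 1.  Let Y >= 0 and Y' be equal in law,
   with T independent of Y and E|Y' - T Y| finite, and put v(M) = E min(Y, M).
   Conditioning on T gives the renewal-type identity
     E[T (v(M) - v(M/T))] = E[min(Y', M) - min(T Y, M)],
   whose right-hand side tends to E[Y' - T Y].  Since E(T - 1) = 0 and v is concave with
   derivative P(Y > M), the identity bounds M P(Y > M).  The increments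
   v(lam M) - v(M) are then bounded and uniformly continuous in log M, and asymptotically
   harmonic for the law of log T tilted by T; if they approach their limsup along some
   M_n, they do so along M_n x for each log x in the closed semigroup generated by the
   support of log T, which is all of R.  Inserting this into the identity identifies the
   limsup and the liminf up to O(log lam), and lam -> 1 gives
     M P(Y > M) --> E[Y' - T Y] / E[T log T].
   With Y = (X+)^alpha and Y' = (Psi(X)+)^alpha this is the existence of C.

   For positivity the same result is applied to Y = H(X), Y' = H(Psi(X)), where
   H(x) = ((x+)^alpha - c (x+)^beta)+ with beta slightly smaller than alpha.  Because
   E A^beta < 1, for large c the function H is strictly subharmonic wherever it is
   positive, so E[Y' - T Y] > 0; and H(X) <= (X+)^alpha. *)

(** * Expectations and independence *)

(** The tail of Y is expected to decay like 1 / M, so E Y is in general infinite and E[Y' - T Y]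
    cannot be split. The truncated mean v(M), expected to grow like C log M, is the finite
    substitute: if v(M) - v(M / T) is about C log T, the identity reads C E[T log T] = E[Y' - T Y].
    Increments of v are followed rather than v because they are bounded and satisfy a homogeneous
    asymptotic equation; a maximum principle for the tilted walk then takes the place of Blackwell's
    renewal theorem. The formula for C yields only a nonnegative limit, since Y' - T Y has no sign.
    Subtracting c (x+)^beta creates a drift, because this term loses the proportion 1 - E A^beta in
    mean. The condition beta > alpha - 1 brings the errors due to B down to order beta in x, where a
    large c beats them; errors that do not grow with x are beaten because H is positive only where
    x^beta is large. *)

Section Expectation.
Context {d : measure_display} {Om : measurableType d} {R : realType}.
Variable P : probability Om R.
Implicit Types f g : Om -> R.

Definition L1 f := P.-integrable [set: Om] (EFin \o f).

Lemma L1_measurable f : L1 f -> measurable_fun [set: Om] f.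
Proof. by move=> /integrableP[/measurable_EFinP]. Qed.

Lemma L1_le f g : measurable_fun [set: Om] f -> L1 g ->
  (forall w, `|f w| <= g w) -> L1 f.
Proof.
move=> mf ig fg; apply: (le_integrable measurableT _ _ ig).
  exact/measurable_EFinP.
move=> w _ /=; rewrite lee_fin (le_trans (fg w))//; exact: ler_norm.
Qed.

Lemma L1_ge0 f : measurable_fun [set: Om] f -> (forall w, 0 <= f w) ->
  (\int[P]_w (f w)%:E < +oo)%E -> L1 f.
Proof.
move=> mf f0 foo; apply/integrableP; split; first exact/measurable_EFinP.
by under eq_integral do rewrite /= ger0_norm//.
Qed.

Lemma L1_fineK f : L1 f -> (\int[P]_w f w)%:E = (\int[P]_w (f w)%:E)%E.
Proof. by move=> ?; rewrite fineK//; exact: integrable_fin_num. Qed.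

Lemma L1_lty f : L1 f -> (\int[P]_w (f w)%:E < +oo)%E.
Proof. by move=> /L1_fineK <-; exact: ltry. Qed.

Lemma L1_ae_le f g : measurable_fun [set: Om] f -> L1 g ->
  {ae P, forall w, `|f w| <= g w} -> L1 f.
Proof.
move=> mf ig fg; apply/integrableP; split; first exact/measurable_EFinP.
apply: (@le_lt_trans _ _ (\int[P]_w (`|g w|)%:E)%E); last first.
  by case/integrableP : ig.
apply: ae_ge0_le_integral => //=.
- exact/measurable_EFinP/measurableT_comp.
- by apply/measurable_EFinP/measurableT_comp => //; exact: L1_measurable ig.
- apply: filterS fg => w fg _; rewrite lee_fin (le_trans fg)//; exact: ler_norm.
Qed.

Lemma L1_cst (c : R) : L1 (fun=> c).
Proof. exact: finite_measure_integrable_cst. Qed.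

Lemma L1_bounded f (K : R) : measurable_fun [set: Om] f ->
  (forall w, `|f w| <= K) -> L1 f.
Proof. by move=> mf fK; apply: (L1_le f (fun=> K)) => //; exact: L1_cst. Qed.

Lemma L1D f g : L1 f -> L1 g -> L1 (fun w => f w + g w).
Proof.
move=> Lf Lg; apply: eq_integrable (integrableD measurableT Lf Lg) => //.
Qed.

Lemma L1Z (k : R) f : L1 f -> L1 (fun w => k * f w).
Proof.
move=> Lf; apply: eq_integrable (integrableZl measurableT k Lf) => //.
Qed.

Lemma L1N f : L1 f -> L1 (fun w => - f w).
Proof.
move=> Lf; have := integrableN Lf; apply: eq_integrable => //.
Qed.

Lemma L1B f g : L1 f -> L1 g -> L1 (fun w => f w - g w).
Proof. by move=> *; apply: L1D => //; exact: L1N. Qed.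

Lemma L1_norm f : L1 f -> L1 (fun w => `|f w|).
Proof. exact: integrable_norm. Qed.

Lemma ExD f g : L1 f -> L1 g ->
  \int[P]_w (f w + g w) = \int[P]_w f w + \int[P]_w g w.
Proof. exact: RintegralD. Qed.

Lemma ExB f g : L1 f -> L1 g ->
  \int[P]_w (f w - g w) = \int[P]_w f w - \int[P]_w g w.
Proof. exact: RintegralB. Qed.

Lemma ExZ (k : R) f : L1 f -> \int[P]_w (k * f w) = k * \int[P]_w f w.
Proof. by move=> ?; exact: RintegralZl. Qed.

Lemma ExN f : L1 f -> \int[P]_w (- f w) = - \int[P]_w f w.
Proof.
move=> Lf; rewrite -[RHS]mulN1r -ExZ//.
by apply: eq_Rintegral => w _; rewrite mulN1r.
Qed.

Lemma Ex_cst (c : R) : \int[P]_w c = c.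
Proof. by rewrite Rintegral_cst// [X in fine X]probability_setT mulr1. Qed.

Lemma le_Ex f g : L1 f -> L1 g -> (forall w, f w <= g w) ->
  \int[P]_w f w <= \int[P]_w g w.
Proof. by move=> ? ? fg; apply: le_Rintegral. Qed.

Lemma Ex_ge0 f : (forall w, 0 <= f w) -> 0 <= \int[P]_w f w.
Proof. by move=> f0; exact: Rintegral_ge0. Qed.

Lemma le_norm_Ex f : L1 f -> `|\int[P]_w f w| <= \int[P]_w `|f w|.
Proof. by move=> Lf; apply: le_normr_Rintegral. Qed.

Lemma Ex_ae_ge0 f : L1 f -> {ae P, forall w, 0 <= f w} -> 0 <= \int[P]_w f w.
Proof.
move=> Lf f0; have mf := L1_measurable _ Lf.
rewrite (_ : Rintegral _ _ _ = \int[P]_w `|f w|); first exact: Ex_ge0.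
congr fine; apply: ae_eq_integral => //.
- exact/measurable_EFinP.
- exact/measurable_EFinP/measurableT_comp.
- by apply: filterS f0 => w f0 _; rewrite ger0_norm.
Qed.

(** Used for the equality case of convexity inequalities: if they are sharp in mean, they are sharp
    almost surely. *)
Lemma Ex_ae_eq0 f : L1 f -> {ae P, forall w, 0 <= f w} -> \int[P]_w f w <= 0 ->
  {ae P, forall w, f w = 0}.
Proof.
move=> Lf f0 Ef; have mf := L1_measurable _ Lf.
have [//|+ _] := @ae_eq_integral_abs _ _ _ P _ measurableT (EFin \o f).
  exact/measurable_EFinP.
have -> : (\int[P]_w `|(EFin \o f) w| = 0)%E.
  rewrite (ae_eq_integral (EFin \o f))//.
  - rewrite -L1_fineK//; apply/eqP; rewrite eqe eq_le Ef/=; exact: Ex_ae_ge0.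
  - exact/measurable_EFinP/measurableT_comp.
  - exact/measurable_EFinP.
  - by apply: filterS f0 => w f0 _ /=; rewrite ger0_norm.
by move=> /(_ erefl); apply: filterS => w /(_ Logic.I)[].
Qed.

Lemma Ex_ae_le f g : L1 f -> L1 g -> {ae P, forall w, f w <= g w} ->
  \int[P]_w f w <= \int[P]_w g w.
Proof.
move=> Lf Lg fg; rewrite -subr_ge0 -ExB//; apply: Ex_ae_ge0; first exact: L1B.
by apply: filterS fg => w; rewrite subr_ge0.
Qed.

Lemma Ex_indic (S : set Om) : measurable S -> \int[P]_w \1_S w = fine (P S).
Proof. by move=> mS; rewrite /Rintegral integral_indic// setIT. Qed.

Lemma L1_indic (S : set Om) : measurable S -> L1 (\1_S).
Proof.
move=> mS; apply: (L1_bounded _ 1) => // w.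
by rewrite indicE; case: (w \in S); rewrite ?normr1 ?normr0.
Qed.

Lemma Ex_dct (f_ : (Om -> R)^nat) f g : (forall n, measurable_fun [set: Om] (f_ n)) ->
  measurable_fun [set: Om] f -> (forall w, f_ ^~ w @ \oo --> f w) -> L1 g ->
  (forall n w, `|f_ n w| <= g w) ->
  (\int[P]_w f_ n w) @[n --> \oo] --> \int[P]_w f w.
Proof.
move=> mf_ mf f_f Lg f_g.
have [] := @dominated_convergence _ _ _ P _ measurableT
  (fun n => EFin \o f_ n) (EFin \o f) (EFin \o g).
- by move=> n; exact/measurable_EFinP.
- exact/measurable_EFinP.
- by apply: aeW => w _; apply: (cvg_EFin _ (f_f w)); apply: nearW => n.
- exact: Lg.
- by apply: aeW => w n _; rewrite /= lee_fin.
move=> Lf _ h; apply: fine_cvg; rewrite fineK//.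
exact: integrable_fin_num.
Qed.

End Expectation.

Section Independence.
Context {d d1 d2 : measure_display} {Om : measurableType d} {R : realType}.
Context {T1 : measurableType d1} {T2 : measurableType d2}.
Variables (P : probability Om R) (Y1 : Om -> T1) (Y2 : Om -> T2).
Hypotheses (mY1 : measurable_fun [set: Om] Y1) (mY2 : measurable_fun [set: Om] Y2).
Hypothesis indepY : indep P Y1 Y2.

(** The joint law agrees with the product of the two laws on rectangles, hence everywhere, and
    Tonelli applies. The inner integral over a second point [w'] replaces a conditional
    expectation. *)
Lemma indep_tonelli (f : T1 * T2 -> \bar R) : measurable_fun [set: T1 * T2] f ->
  (forall z, 0 <= f z)%E ->
  (\int[P]_w f (Y1 w, Y2 w) = \int[P]_w \int[P]_w' f (Y1 w, Y2 w'))%E.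
Proof.
move=> mf f0.
have mY12 : measurable_fun [set: Om] (fun w => (Y1 w, Y2 w)).
  exact: measurable_fun_pair.
pose Y1' : {mfun Om >-> T1} := HB.pack Y1 (isMeasurableFun.Build _ _ _ _ _ mY1).
pose Y2' : {mfun Om >-> T2} := HB.pack Y2 (isMeasurableFun.Build _ _ _ _ _ mY2).
pose Y' : {mfun Om >-> (T1 * T2)%type} :=
  HB.pack (fun w => (Y1 w, Y2 w)) (isMeasurableFun.Build _ _ _ _ _ mY12).
pose m1 : probability T1 R := distribution P Y1'.
pose m2 : probability T2 R := distribution P Y2'.
pose m : probability _ R := distribution P Y'.
have prodE : forall S : set (T1 * T2), measurable S -> (m1 \x m2)%E S = m S.
  apply: product_measure_unique => A B mA mB.
  rewrite /m /m1 /m2 /distribution /pushforward/= -indepY//.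
transitivity (\int[m]_z f z)%E.
  by rewrite ge0_integral_pushforward//; move=> z _; exact: f0.
transitivity (\int[m1 \x m2]_z f z)%E.
  by apply: eq_measure_integral => S mS _; first [exact: (esym (prodE S mS))|exact: prodE].
rewrite fubini_tonelli1// ge0_integral_pushforward//; last 2 first.
- exact: measurable_fun_fubini_tonelli_F.
- by move=> x _; apply: integral_ge0 => *; exact: f0.
apply: eq_integral => w _ /=; rewrite /fubini_F ge0_integral_pushforward//.
exact: measurableT_comp.
Qed.

Lemma indep_integralM (f : T1 -> R) (g : T2 -> R) :
  measurable_fun [set: T1] f -> measurable_fun [set: T2] g ->
  (forall x, 0 <= f x) -> (forall x, 0 <= g x) ->
  L1 P (f \o Y1) -> L1 P (g \o Y2) ->
  L1 P (fun w => f (Y1 w) * g (Y2 w)) /\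
  \int[P]_w (f (Y1 w) * g (Y2 w)) = \int[P]_w f (Y1 w) * \int[P]_w g (Y2 w).
Proof.
move=> mf mg f0 g0 Lf Lg.
have mfY : measurable_fun [set: Om] (f \o Y1) by exact: measurableT_comp.
have mgY : measurable_fun [set: Om] (g \o Y2) by exact: measurableT_comp.
have mfg : measurable_fun [set: T1 * T2] (fun z => (f z.1 * g z.2)%:E).
  apply/measurable_EFinP; apply: measurable_funM.
    by apply: measurableT_comp => //; exact: measurable_fst.
  by apply: measurableT_comp => //; exact: measurable_snd.
have E : (\int[P]_w (f (Y1 w) * g (Y2 w))%:E =
    (\int[P]_w f (Y1 w) * \int[P]_w g (Y2 w))%:E)%E.
  rewrite (indep_tonelli (fun z => (f z.1 * g z.2)%:E))//=; last first.
    by move=> z; rewrite lee_fin mulr_ge0.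
  transitivity (\int[P]_w ((f (Y1 w))%:E * (\int[P]_w g (Y2 w))%:E))%E.
    apply: eq_integral => w _; rewrite (L1_fineK _ (g \o Y2))// -ge0_integralZl//.
    - exact/measurable_EFinP.
    - by move=> x _; rewrite lee_fin; exact: g0.
    - by rewrite lee_fin; exact: f0.
  rewrite ge0_integralZr//; last 3 first.
  - exact/measurable_EFinP.
  - by move=> x _; rewrite lee_fin; exact: f0.
  - by rewrite lee_fin; apply: Ex_ge0 => w; exact: g0.
  by rewrite -(L1_fineK _ (f \o Y1)).
split; last by rewrite {1}/Rintegral E.
apply: L1_ge0; first exact: (measurable_funM mfY mgY).
- by move=> w; rewrite mulr_ge0.
- by rewrite E ltry.
Qed.

End Independence.

(** * Closed subsemigroups of the line and supports of laws *)

Lemma closed_semigroup_dense_or_lattice {R : realType} (S : set R) (a b : R) :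
  (forall x, (forall e, 0 < e -> exists2 y, S y & `|x - y| < e) -> S x) ->
  S 0 -> (forall x y, S x -> S y -> S (x + y)) ->
  S a -> 0 < a -> S b -> b < 0 ->
  (forall x, S x) \/
  (exists c, 0 < c /\ forall x, S x -> exists k : int, x = k%:~R * c).
Proof.
move=> Scl S0 SD Sa a0 Sb b0.
have SM n x : S x -> S (n%:R * x).
  move=> Sx; elim: n => [|n IH]; first by rewrite mul0r.
  by rewrite -natr1 mulrDl mul1r; exact: SD.
have below x : exists n : nat, n%:R * b <= x.
  exists (Num.trunc (`|x| / - b)).+1.
  have := truncnS_gt (`|x| / - b).
  rewrite ltr_pdivrMr ?oppr_gt0// mulrN => h.
  by have := ler_norm (- x); rewrite normrN => h'; lra.
have [small|] := pselect (forall e, 0 < e -> exists g, [/\ S g, 0 < g & g < e]).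
  (* Start below [x] at a multiple of [b] and climb by steps of [g], which are shorter than [e]. *)
  left => x; apply: Scl => e e0; have [g [Sg g0 ge]] := small _ e0.
  have [n nb] := below x.
  have h0 : 0 <= (x - n%:R * b) / g.
    by apply: divr_ge0; [rewrite subr_ge0|exact: ltW].
  exists (n%:R * b + (Num.trunc ((x - n%:R * b) / g))%:R * g).
    by apply: SD; exact: SM.
  have /andP[] := truncn_itv h0; set k := Num.trunc _.
  rewrite ler_pdivlMr// ltr_pdivrMr// -natr1 mulrDl mul1r => h1 h2.
  rewrite opprD addrA ger0_norm; lra.
move=> /existsNP[e /not_implyP[e0 /forallNP he]]; right.
have Se g : S g -> 0 < g -> e <= g.
  by move=> Sg g0; rewrite leNgt; apply/negP => ge; exact: (he g).
pose Q := [set x | S x /\ 0 < x]; pose c := inf Q.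
have Qlb : lbound Q e by move=> x [Sx x0]; exact: Se.
have Qinf : has_inf Q by split; [exists a | exists e].
have c0 : 0 < c by apply: (lt_le_trans e0); apply: lb_le_inf => //; exists a.
have cle x : S x -> 0 < x -> c <= x.
  by move=> Sx x0; apply: ge_inf; [exists e|].
have Sc : S c.
  apply: Scl => eps eps0; have [y Qy hy] := inf_adherent eps0 Qinf.
  exists y; first by case: Qy.
  by rewrite distrC ger0_norm; have := cle _ Qy.1 Qy.2; rewrite -/c in hy; lra.
(* With [k] the integer part of [- x / c], the element [x + (k + 1) c] lies in ]0, c], so it equals
   [c] by minimality. *)
have neg x : S x -> x < 0 -> exists k : nat, x = - k%:R * c.
  move=> Sx x0; set k := Num.trunc (- x / c).
  have hx0 : 0 <= - x / c by rewrite divr_ge0 ?ltW// oppr_gt0.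
  have /andP[] := truncn_itv hx0; rewrite -/k.
  rewrite ler_pdivlMr// ltr_pdivrMr// -natr1 mulrDl mul1r => h1 h2.
  exists k.
  have Sy : S (x + (k%:R * c + c)) by apply: (SD) => //; apply: SD => //; exact: SM.
  have := cle _ Sy; lra.
(* A multiple of [b] moves any [x] below 0, and [b] is itself a multiple of [c]. *)
exists c; split=> // x Sx; have [n nb] := below (- x - 1).
have [k hk] : exists k : nat, x + n%:R * b = - k%:R * c.
  by apply: neg; [apply: (SD) => //; exact: SM|lra].
have [j hj] := neg _ Sb b0.
exists (n%:Z * j%:Z - k%:Z); rewrite rmorphB/= rmorphM/= mulrBl.
rewrite -!pmulrn -mulrA; move: hk; rewrite hj; lra.
Qed.

Section Support.
Context {d : measure_display} {Om : measurableType d} {R : realType}.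
Variables (P : probability Om R) (X : Om -> R).
Hypothesis mX : measurable_fun [set: Om] X.

(** The complement of the support is covered by countably many null balls with rational centre and
    radius 1 / (n + 1). *)
Lemma law_support_ae : {ae P, forall w, law_support P X (X w)}.
Proof.
(* [k] runs over codes of pairs (centre, index of the radius); numbers that code nothing impose no
   condition. *)
pose prop (k : nat) (w : Om) := match @unpickle (rat * nat)%type k with
  | Some z => P (X @^-1` ball (ratr z.1 : R) z.2.+1%:R^-1) = 0%E ->
              ~ ball (ratr z.1 : R) z.2.+1%:R^-1 (X w)
  | None => True end.
have : {ae P, forall w, forall k, prop k w}.
  apply: ae_foralln => k; rewrite /prop; case: unpickle => [[q n]|]/=; last exact: aeW.
  have [P0|nP0] := pselect (P (X @^-1` ball (ratr q : R) n.+1%:R^-1) = 0%E); last first.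
    by apply: aeW.
  exists (X @^-1` ball (ratr q : R) n.+1%:R^-1); split => //.
    by rewrite -[X in measurable X]setTI; apply: mX => //; exact: measurable_ball.
  by move=> w /= /not_implyP[_ /contrapT].
apply: filterS => w hw e e0; rewrite lt0e measure_ge0 andbT; apply/eqP => Pe0.
have [n ne] : exists n : nat, n.+1%:R^-1 < e / 2.
  exists (Num.trunc (2 / e)); have := truncnS_gt (2 / e).
  rewrite ltr_pdivrMr// => h; rewrite invf_plt ?posrE ?divr_gt0//.
  by rewrite invf_div ltr_pdivrMr.
have n0 : 0 < n.+1%:R^-1 :> R by rewrite invr_gt0.
have /rat_in_itvoo[q] : X w < X w + n.+1%:R^-1 by rewrite ltrDl.
rewrite in_itv/= => /andP[q1 q2].
have qX : ball (ratr q : R) n.+1%:R^-1 (X w).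
  rewrite /ball/= ltr_norml; move: q1 q2 n0.
  by move: (n.+1%:R^-1) (ratr q) (X w) => r z x; lra.
have := hw (pickle (q, n)); rewrite /prop pickleK/=; apply=> //.
apply/eqP; rewrite eq_le measure_ge0 andbT -Pe0; apply: le_measure.
- by rewrite inE -[X in measurable X]setTI; apply: mX => //; exact: measurable_ball.
- by rewrite inE -[X in measurable X]setTI; apply: mX => //; exact: measurable_ball.
move=> v /=; rewrite /ball/= => h; have := qX; rewrite /ball/= => h'.
rewrite (_ : _ - _ = (X w - ratr q) + (ratr q - X v)); last by ring.
rewrite (le_lt_trans (ler_normD _ _))// [`|X w - _|]distrC.
by move: h h' ne; move: n.+1%:R^-1 => r; lra.
Qed.

Lemma ae_lattice_arithmetic (c : R) : 0 < c ->
  {ae P, forall w, exists k : int, X w = k%:~R * c} -> arithmetic_law P X.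
Proof.
move=> c0 h; exists c; split => //.
set S := (X in P X).
have mS : measurable S.
  rewrite (_ : S = \bigcup_(k : int) (X @^-1` [set k%:~R * c])).
    apply: countable_bigcupT_measurable => // k.
    by rewrite -[X in measurable X]setTI; apply: mX => //; exact: measurable_set1.
  by apply/seteqP; split => w /=; [move=> [k kE]; exists k|move=> [k _ kE]; exists k].
have : P (~` S) = 0%E by apply/negligibleP => //; exact: measurableC.
rewrite probability_setC// -[P S]fineK ?fin_num_measure// -EFinB => -[/eqP].
by rewrite subr_eq0 => /eqP <-.
Qed.

End Support.

(** * Exponential tilting *)

Section Tilt.
Context {d : measure_display} {Om : measurableType d} {R : realType}.
Variables (P : probability Om R) (xi : Om -> R).
Hypothesis mxi : measurable_fun [set: Om] xi.
Hypothesis LT : L1 P (fun w => expR (xi w)).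
Hypothesis ET : \int[P]_w expR (xi w) = 1.
Hypothesis nonarith : ~ arithmetic_law P xi.

Lemma tilt_not_ae0 : ~ {ae P, forall w, xi w = 0}.
Proof.
move=> h; apply: nonarith; apply: (ae_lattice_arithmetic _ _ mxi 1) => //.
by apply: filterS h => w ->; exists 0; rewrite mul0r.
Qed.

(** Otherwise [1 - expR (xi w)] is nonnegative almost surely with mean 0, hence vanishes, and the
    law of [xi] sits at 0. *)
Lemma tilt_support_gt0 : exists y, law_support P xi y /\ 0 < y.
Proof.
apply: contrapT => /forallNP h.
have xi0 : {ae P, forall w, xi w <= 0}.
  apply: filterS (law_support_ae P _ mxi) => w hw; rewrite leNgt; apply/negP => w0.
  exact: (h (xi w)).
apply: tilt_not_ae0.
have : {ae P, forall w, 1 - expR (xi w) = 0}.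
  apply: Ex_ae_eq0.
  - by apply: L1B => //; exact: L1_cst.
  - by apply: filterS xi0 => w w0; rewrite subr_ge0 -expR0 ler_expR.
  - by rewrite ExB ?ET ?Ex_cst ?subrr//; exact: L1_cst.
by apply: filterS => w /eqP; rewrite subr_eq0 -expR0 => /eqP/expR_inj.
Qed.

Lemma tilt_support_lt0 : exists y, law_support P xi y /\ y < 0.
Proof.
apply: contrapT => /forallNP h.
have xi0 : {ae P, forall w, 0 <= xi w}.
  apply: filterS (law_support_ae P _ mxi) => w hw; rewrite leNgt; apply/negP => w0.
  exact: (h (xi w)).
apply: tilt_not_ae0.
have : {ae P, forall w, expR (xi w) - 1 = 0}.
  apply: Ex_ae_eq0.
  - by apply: L1B => //; exact: L1_cst.
  - by apply: filterS xi0 => w w0; rewrite subr_ge0 -expR0 ler_expR.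
  - by rewrite ExB ?ET ?Ex_cst ?subrr//; exact: L1_cst.
by apply: filterS => w /eqP; rewrite subr_eq0 -expR0 => /eqP/expR_inj.
Qed.

(** One has [x exp x >= exp x - 1], with equality only at 0, and the right side has mean 0 by
    [ET]. *)
Lemma tilt_mean_gt0 : L1 P (fun w => expR (xi w) * xi w) ->
  0 < \int[P]_w (expR (xi w) * xi w).
Proof.
move=> LTx; rewrite ltNge; apply/negP => h; apply: tilt_not_ae0.
have ge x : 0 <= expR x * x - (expR x - 1) :> R.
  have := expR_ge1Dx (- x); have := expR_gt0 x; rewrite expRN => h0.
  by rewrite -(ler_pM2l h0) divff ?gt_eqF//; lra.
have : {ae P, forall w, expR (xi w) * xi w - (expR (xi w) - 1) = 0}.
  apply: Ex_ae_eq0.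
  - by apply: L1B => //; apply: L1B => //; exact: L1_cst.
  - by apply: aeW => w; exact: ge.
  - rewrite ExB//; last by apply: L1B => //; exact: L1_cst.
    by rewrite ExB ?ET ?Ex_cst ?subrr ?subr0//; exact: L1_cst.
apply: filterS => w hw; apply/eqP/negPn/negP => x0.
have : - xi w != 0 by rewrite oppr_eq0.
move=> /expR_gt1Dx; rewrite expRN; have h0 := expR_gt0 (xi w).
by rewrite -(ltr_pM2l h0) divff ?gt_eqF//; lra.
Qed.

(** By convexity [exp (g x) <= g exp x + (1 - g)], whose right side has mean 1; equality in mean
    would force [xi = 0]. *)
Lemma tilt_moment_lt1 g : 0 < g -> g < 1 ->
  L1 P (fun w => expR (g * xi w)) /\ \int[P]_w expR (g * xi w) < 1.
Proof.
move=> g0 g1.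
have g1' : 0 < 1 - g by rewrite subr_gt0.
have split x : expR x = expR (g * x) * expR ((1 - g) * x) :> R.
  by rewrite -expRD; congr expR; ring.
have split1 x : 1 = expR (g * x) * expR (- (g * x)) :> R.
  by rewrite -expRD subrr expR0.
(* Quantitative convexity: this lower bound is positive unless [x = 0]. It comes from
   [exp z >= 1 + z] at [z = (1 - g) x]. *)
have gap x : expR (g * x) * (1 - g) * (expR (- (g * x)) - (1 - g * x)) <=
    g * expR x + (1 - g) - expR (g * x).
  have hz := expR_ge1Dx ((1 - g) * x); have y0 := expR_gt0 (g * x).
  have hn := split1 x; rewrite (split x).
  move: hz y0 hn; move: (expR ((1 - g) * x)) (expR (- (g * x))) (expR (g * x)).
  move=> z n y hz y0 hn.
  rewrite (_ : _ * _ = (1 - g) * (y * n) - y * (1 - g) * (1 - g * x)); last by ring.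
  by rewrite -hn; move: hz; rewrite -(ler_pM2l (mulr_gt0 g0 y0)); lra.
have gap0 x : 0 <= g * expR x + (1 - g) - expR (g * x).
  apply: le_trans (gap x); rewrite !mulr_ge0 ?expR_ge0 ?(ltW g1')// subr_ge0.
  exact: expR_ge1Dx.
have Lg : L1 P (fun w => expR (g * xi w)).
  apply: (L1_le P _ (fun w => g * expR (xi w) + (1 - g))).
  - by apply: measurableT_comp => //; apply: measurable_funM => //; exact: measurable_cst.
  - by apply: L1D; [exact: L1Z|exact: L1_cst].
  - by move=> w; rewrite ger0_norm ?expR_ge0// -subr_ge0.
split => //; rewrite ltNge; apply/negP => h; apply: tilt_not_ae0.
have Lb : L1 P (fun w => g * expR (xi w) + (1 - g)).
  by apply: L1D; [exact: L1Z|exact: L1_cst].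
have : {ae P, forall w, g * expR (xi w) + (1 - g) - expR (g * xi w) = 0}.
  apply: Ex_ae_eq0; first exact: L1B.
    by apply: aeW => w; exact: gap0.
  rewrite ExB// ExD ?ExZ ?ET ?Ex_cst ?mulr1; [|by []|exact: L1Z|exact: L1_cst].
  by rewrite (addrC g) subrK subr_le0.
apply: filterS => w hw; apply/eqP/negPn/negP => x0.
have /expR_gt1Dx : - (g * xi w) != 0 by rewrite oppr_eq0 mulf_neq0// gt_eqF.
rewrite -subr_gt0 => h1; have := gap (xi w); rewrite hw leNgt => /negP; apply.
by rewrite !mulr_gt0 ?expR_gt0.
Qed.

(** * Maximum principle for asymptotically harmonic functions *)

Section Spread.
Variables (f : R -> R) (K : R).
Hypothesis f_bounded : forall s, `|f s| <= K.
Hypothesis f_uc : forall e, 0 < e -> exists2 del, 0 < del &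
  forall s t, `|s - t| < del -> `|f s - f t| < e.
Hypothesis f_harm :
  (\int[P]_w (expR (xi w) * (f s - f (s - xi w)))) @[s --> +oo] --> (0 : R).

Let mf : measurable_fun [set: R] f.
Proof.
apply: continuous_measurable_fun => x; apply/cvgrPdist_lt => e e0.
have [del del0 h] := f_uc _ e0.
near=> t; apply: h; near: t.
by apply: cvgr_dist_lt.
Unshelve. all: by end_near. Qed.

Let mfxi s : measurable_fun [set: Om] (fun w => f (s - xi w)).
Proof.
apply: (measurableT_comp mf).
by apply: measurable_funB => //; exact: measurable_cst.
Qed.

Let LTf (g : Om -> R) (C : R) : measurable_fun [set: Om] g ->
  (forall w, `|g w| <= C) -> L1 P (fun w => expR (xi w) * g w).
Proof.
move=> mg gC; apply: (L1_le P _ (fun w => C * expR (xi w))).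
- apply: measurable_funM => //; exact: L1_measurable LT.
- exact: L1Z.
- move=> w; rewrite normrM ger0_norm ?expR_ge0// mulrC ler_wpM2r//.
Qed.

Variable eta : R.
Hypothesis f_le : forall e, 0 < e -> exists N, forall s, N <= s -> f s <= eta + e.

(** A mean of values that asymptotically do not exceed [eta] can tend to [eta] only if the values
    do. So [f (v n - xi)] approaches [eta] in mean with weight [expR (xi w)]; positive mass near [y]
    and uniform continuity carry this to [y] itself. *)
Lemma spread_support (v : R^nat) (y : R) : v @ \oo --> +oo ->
  f (v n) @[n --> \oo] --> eta -> law_support P xi y ->
  f (v n - y) @[n --> \oo] --> eta.
Proof.
move=> voo fv supy.
have eta_K : `|eta| <= K.
  rewrite ler_norml; apply/andP; split.
    rewrite lerNl; apply/ler_addgt0Pl => e e0.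
    have [N hN] := f_le _ e0; have := hN _ (lexx N).
    by have := f_bounded N; rewrite ler_norml => /andP[]; lra.
  apply/ler_addgt0Pl => e e0.
  have /cvgrPdist_lt/(_ e e0)[n _ /(_ n (leqnn n))] := fv.
  by rewrite ltr_norml => /andP[_]; have := f_bounded (v n); rewrite ler_norml => /andP[]; lra.
(* Excess over [eta], which dominated convergence sends to 0 thanks to [f_le]. *)
pose g n w := Num.max 0 (f (v n - xi w) - eta).
have mg n : measurable_fun [set: Om] (g n).
  apply: measurable_maxr; first exact: measurable_cst.
  by apply: measurable_funB; [exact: mfxi|exact: measurable_cst].
have g_bd n w : `|g n w| <= 2 * K.
  rewrite ger0_norm ?le_max ?lexx// ge_max.
  have := f_bounded (v n - xi w); move: eta_K; rewrite !ler_norml => /andP[? ?] /andP[? ?].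
  by apply/andP; split; lra.
have Eg : \int[P]_w (expR (xi w) * g n w) @[n --> \oo] --> (0 : R).
  rewrite -[X in _ --> X](Ex_cst P 0).
  apply: (@Ex_dct _ _ _ P _ _ (fun w => (2 * K) * expR (xi w))).
  - by move=> n; apply: measurable_funM; [exact: L1_measurable LT|exact: mg].
  - exact: measurable_cst.
  - move=> w; rewrite -(mulr0 (expR (xi w))); apply: cvgMr.
    apply/cvgrPdist_le => e e0; have [N hN] := f_le _ e0.
    near=> n; rewrite sub0r normrN ger0_norm ?le_max ?lexx// ge_max ltW//=.
    rewrite lerBlDl; apply: hN; rewrite lerBrDl.
    by near: n; move/cvgryPge : voo; exact.
  - exact: L1Z.
  - move=> n w; rewrite normrM ger0_norm ?expR_ge0// mulrC ler_wpM2r//.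
pose h n w := expR (xi w) * `|eta - f (v n - xi w)|.
have h0 n w : 0 <= h n w by rewrite mulr_ge0 ?expR_ge0.
(* [|x| = x + 2 max(0, - x)] reduces the absolute deviation to terms whose means are known to vanish
   in the limit. *)
have hE n w : h n w = (eta - f (v n)) * expR (xi w) +
    (expR (xi w) * (f (v n) - f (v n - xi w)) + 2 * (expR (xi w) * g n w)).
  rewrite /h /g /Num.max; case: ltP => c.
    by rewrite ltr0_norm; [ring|lra].
  by rewrite ger0_norm; [ring|lra].
have Ldiff s : L1 P (fun w => expR (xi w) * (f s - f (s - xi w))).
  apply: (LTf _ (2 * K)).
    by apply: measurable_funB; [exact: measurable_cst|exact: mfxi].
  move=> w; have := f_bounded s; have := f_bounded (s - xi w).
  by have := ler_normB (f s) (f (s - xi w)); lra.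
have Lg n : L1 P (fun w => expR (xi w) * g n w) by exact: (LTf _ (2 * K)).
have Lh n : L1 P (h n).
  rewrite (funext (hE n)).
  by apply: L1D; [exact: L1Z|apply: L1D => //; exact: L1Z].
have Eh : \int[P]_w h n w @[n --> \oo] --> (0 : R).
  rewrite [X in X @ _ --> _](_ : _ = fun n => (eta - f (v n)) +
    (\int[P]_w (expR (xi w) * (f (v n) - f (v n - xi w))) +
     2 * \int[P]_w (expR (xi w) * g n w))); last first.
    apply/funext => n; rewrite (funext (hE n)).
    rewrite ExD ?ExD ?ExZ ?ET ?mulr1//; try exact: L1Z.
    by apply: L1D => //; exact: L1Z.
  rewrite -[X in _ --> X](addr0 0); apply: cvgD.
    rewrite -(subrr eta); apply: cvgB => //; exact: cvg_cst.
  rewrite -[X in _ --> X](addr0 0); apply: cvgD.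
    exact: (cvg_comp _ _ voo f_harm).
  by rewrite -(mulr0 2); apply: cvgMr.
apply/cvgrPdist_lt => e e0; have e20 : 0 < e / 2 by rewrite divr_gt0.
have [del del0 fdel] := f_uc _ e20.
have mB : measurable (xi @^-1` ball y del).
  by rewrite -[X in measurable X]setTI; apply: mxi => //; exact: measurable_ball.
pose p := fine (P (xi @^-1` ball y del)).
have p0 : 0 < p.
  by apply: fine_gt0; rewrite supy//= -ge0_fin_numE// fin_num_measure.
pose c := expR (y - del) * p.
have c0 : 0 < c by rewrite mulr_gt0 ?expR_gt0.
have ce0 : 0 < c * (e / 2) by rewrite mulr_gt0.
(* If the deviation at [y] is at least [e], then it is at least [e / 2] wherever [xi w] is in the
   ball, with weight at least [expR (y - del)]; the mean of [h n] would be at least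
   [c * (e / 2)]. *)
near=> n; rewrite ltNge; apply/negP => hn.
have : \int[P]_w h n w < c * (e / 2).
  have : `|0 - \int[P]_w h n w| < c * (e / 2).
    by near: n; exact: (cvgr_dist_lt _ _ Eh).
  by rewrite sub0r normrN; exact/le_lt_trans/ler_norm.
apply/negP; rewrite -leNgt.
have -> : c * (e / 2) = \int[P]_w (expR (y - del) * (e / 2) * \1_(xi @^-1` ball y del) w).
  by rewrite ExZ ?Ex_indic//; [rewrite /c -/p; ring|exact: L1_indic].
apply: le_Ex => [||w]; [by apply: L1Z; exact: L1_indic|by []|].
rewrite indicE; case: (boolP (w \in _)) => [|_]; last by rewrite mulr0.
rewrite inE/= mulr1 => hw; apply: ler_pM; [exact: expR_ge0|exact: ltW| |].
  by rewrite ler_expR; move: hw; rewrite /ball/= ltr_norml => /andP[]; lra.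
have : `|f (v n - y) - f (v n - xi w)| < e / 2.
  apply: fdel; rewrite (_ : _ - _ = - (y - xi w)); [rewrite normrN; exact: hw|ring].
move=> h1; have := ler_normB (eta - f (v n - xi w)) (f (v n - y) - f (v n - xi w)).
have -> : eta - f (v n - xi w) - (f (v n - y) - f (v n - xi w)) = eta - f (v n - y).
  by ring.
by lra.
Unshelve. all: by end_near. Qed.

Lemma spread (v : R^nat) (y : R) : v @ \oo --> +oo ->
  f (v n) @[n --> \oo] --> eta -> f (v n - y) @[n --> \oo] --> eta.
Proof.
(* Quantifying over all sequences [v] makes this set of shifts stable under addition: [v n - x] is
   again an admissible sequence. *)
pose S : set R := [set y | forall v : R^nat, v @ \oo --> +oo ->
  f (v n) @[n --> \oo] --> eta -> f (v n - y) @[n --> \oo] --> eta].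
have suppS z : law_support P xi z -> S z.
  by move=> hz u uoo fu; exact: spread_support.
have shift (u : R^nat) z : u @ \oo --> +oo -> (u n - z) @[n --> \oo] --> +oo.
  move=> /cvgryPge uoo; apply/cvgryPge => A; apply: filterS (uoo (A + z)) => n.
  by rewrite lerBrDr.
have [a [suppa a0]] := tilt_support_gt0.
have [b [suppb b0]] := tilt_support_lt0.
have : (forall x, S x) \/
    (exists c, 0 < c /\ forall x, S x -> exists k : int, x = k%:~R * c).
  apply: (closed_semigroup_dense_or_lattice S a b _ _ _
    (suppS _ suppa) a0 (suppS _ suppb) b0).
  - move=> x hx u uoo fu; apply/cvgrPdist_lt => e e0.
  have e20 : 0 < e / 2 by rewrite divr_gt0.
  have [del del0 fdel] := f_uc _ e20.
  have [z Sz xz] := hx _ del0; have := Sz u uoo fu.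
  move=> /cvgrPdist_lt/(_ _ e20); apply: filterS => n hn.
  have : `|f (u n - z) - f (u n - x)| < e / 2.
    by apply: fdel; rewrite (_ : _ - _ = x - z)//; ring.
  have := ler_normD (eta - f (u n - z)) (f (u n - z) - f (u n - x)).
  have -> : eta - f (u n - z) + (f (u n - z) - f (u n - x)) = eta - f (u n - x).
    by ring.
  by lra.
  - move=> u uoo; rewrite [X in _ -> X @ _ --> _](_ : _ = fun n => f (u n))//.
    by apply/funext => n; rewrite subr0.
  - move=> x z Sx Sz u uoo fu.
    rewrite [X in X @ _ --> _](_ : _ = fun n => f (u n - x - z)); last first.
      by apply/funext => n; rewrite opprD addrA.
  by apply: (Sz (fun n => u n - x)); [exact: shift|exact: Sx].
move=> [h|[c [c0 h]]]; first exact: h.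
exfalso; apply: nonarith; apply: (ae_lattice_arithmetic _ _ mxi c) => //.
by apply: filterS (law_support_ae P _ mxi) => w /suppS/h.
Qed.

End Spread.
End Tilt.

(** * Truncated means *)

(** The limsup at infinity as a real number, with a sequence that realises it; [spread] takes both
    as input. *)
Lemma limsup_seq {R : realType} (f : R -> R) (K : R) : (forall s, `|f s| <= K) ->
  exists eta (u : R^nat), [/\ u @ \oo --> +oo, f (u n) @[n --> \oo] --> eta &
    forall e, 0 < e -> exists N, forall s, N <= s -> f s <= eta + e].
Proof.
move=> fK; pose E := [set y | exists N, forall s, N <= s -> f s <= y].
have Elb : lbound E (- K).
  move=> y [N hN]; have := hN _ (lexx N).
  by have := fK N; rewrite ler_norml => /andP[]; lra.
have Einf : has_inf E.
  split; last by exists (- K).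
  by exists K, 0 => s _; rewrite (le_trans (ler_norm _)).
pose eta := inf E.
have H1 e : 0 < e -> exists N, forall s, N <= s -> f s <= eta + e.
  move=> e0; have [y [N hN] hy] := inf_adherent e0 Einf; exists N => s /hN.
  by rewrite -/eta in hy; lra.
have H2 (n : nat) : exists s, n%:R <= s /\ eta - n.+1%:R^-1 < f s.
  apply: contrapT => /forallNP h.
  have : E (eta - n.+1%:R^-1).
    exists n%:R => s hs; rewrite leNgt; apply/negP => h'; exact: (h s).
  move=> /(ge_inf (ex_intro _ _ Elb)); apply/negP; rewrite -ltNge -/eta.
  by rewrite ltrBlDr ltrDl invr_gt0.
have [u hu] := choice H2.
exists eta, u; split => //.
  apply/cvgryPge => A; exists (Num.trunc `|A|).+1 => // n /= hn.
  apply: le_trans (hu n).1; apply: (le_trans (ler_norm A)); apply: ltW.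
  by apply: (lt_le_trans (truncnS_gt _)); rewrite ler_nat.
apply/cvgrPdist_lt => e e0; have e20 : 0 < e / 2 by rewrite divr_gt0.
have [N hN] := H1 _ e20.
exists (maxn (Num.trunc `|N|).+1 (Num.trunc (e^-1))) => // n /=.
rewrite geq_max => /andP[n1 n2].
have [h1 h2] := hu n.
have h3 : f (u n) <= eta + e / 2.
  apply: hN; apply: le_trans h1; apply: (le_trans (ler_norm N)); apply: ltW.
  by apply: (lt_le_trans (truncnS_gt _)); rewrite ler_nat.
have h4 : n.+1%:R^-1 < e.
  rewrite invf_plt ?posrE//; apply: (lt_le_trans (truncnS_gt _)).
  by rewrite ler_nat.
by rewrite ltr_norml; move: h2 h3 h4; move: (n.+1%:R^-1) => r; lra.
Qed.

Lemma eq_law_integral {d} {Om : measurableType d} {R : realType}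
    (P : probability Om R) (Z Z' : Om -> R) (phi : R -> \bar R) :
  measurable_fun [set: Om] Z -> measurable_fun [set: Om] Z' ->
  (forall S, measurable S -> P (Z @^-1` S) = P (Z' @^-1` S)) ->
  measurable_fun [set: R] phi -> (forall x, 0 <= phi x)%E ->
  (\int[P]_w phi (Z w) = \int[P]_w phi (Z' w))%E.
Proof.
move=> mZ mZ' ZZ' mphi phi0.
pose Y : {mfun Om >-> R} := HB.pack Z (isMeasurableFun.Build _ _ _ _ _ mZ).
pose Y' : {mfun Om >-> R} := HB.pack Z' (isMeasurableFun.Build _ _ _ _ _ mZ').
transitivity (\int[distribution P Y]_x phi x)%E.
  by rewrite ge0_integral_pushforward//; move=> x _; exact: phi0.
transitivity (\int[distribution P Y']_x phi x)%E.
  by apply: eq_measure_integral => S mS _; exact: ZZ'.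
by rewrite ge0_integral_pushforward//; move=> x _; exact: phi0.
Qed.

Section Increments.
Context {d : measure_display} {Om : measurableType d} {R : realType}.
Variables (P : probability Om R) (Z : Om -> R).
Hypothesis mZ : measurable_fun [set: Om] Z.
Hypothesis Z0 : forall w, 0 <= Z w.

Definition tail (M : R) : R := fine (P [set w | M < Z w]).
Definition tmean (M : R) : R := \int[P]_w Num.min (Z w) M.

Lemma tail_ge0 M : 0 <= tail M. Proof. exact: fine_ge0. Qed.

Lemma measurable_tail M : measurable [set w | M < Z w].
Proof.
rewrite (_ : [set w | _] = Z @^-1` `]M, +oo[).
  by rewrite -[X in measurable X]setTI; exact: mZ.
by apply/seteqP; split => w /=; rewrite in_itv/= andbT.
Qed.
Hint Resolve measurable_tail : core.

Lemma tailE M : (tail M)%:E = P [set w | M < Z w].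
Proof. by rewrite fineK// fin_num_measure. Qed.

Lemma tail_nonincr M N : M <= N -> tail N <= tail M.
Proof.
move=> MN; rewrite -lee_fin !tailE; apply: le_measure; rewrite ?inE//.
by move=> w /=; exact: le_lt_trans.
Qed.

Lemma tail_cvg0 (u : R^nat) : u @ \oo --> +oo -> tail (u n) @[n --> \oo] --> 0.
Proof.
move=> /cvgryPge uoo.
rewrite -[X in _ --> X](Ex_cst P 0).
rewrite [X in X @ _ --> _](_ : _ = fun n => \int[P]_w \1_[set w | u n < Z w] w); last first.
  by apply/funext => n; rewrite Ex_indic.
apply: (@Ex_dct _ _ _ P _ _ (fun=> 1)).
- by move=> n; exact: measurable_indic.
- exact: measurable_cst.
- move=> w; apply/cvgrPdist_lt => e e0; apply: filterS (uoo (Z w)) => n hn.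
  by rewrite indicE memNset ?subrr ?normr0//=; apply/negP; rewrite -leNgt.
- exact: L1_cst.
- by move=> n w; rewrite indicE; case: (w \in _); rewrite ?normr1 ?normr0.
Qed.

Lemma L1_min M : 0 <= M -> L1 P (fun w => Num.min (Z w) M).
Proof.
move=> M0; apply: (L1_bounded P _ M).
  by apply: measurable_minr => //; exact: measurable_cst.
by move=> w; rewrite ger0_norm ?le_min ?Z0// ge_min lexx orbT.
Qed.

(** The two truncations differ by [b - a] where [b < Z] and by 0 where [Z <= a]. Concavity of
    [tmean] and its derivative are used only in this two-sided form. *)
Lemma tmean_incr a b : 0 <= a -> a <= b ->
  tail b * (b - a) <= tmean b - tmean a <= tail a * (b - a).
Proof.
move=> a0 ab; have b0 : 0 <= b by exact: le_trans ab.
rewrite /tmean -ExB; [|exact: L1_min..].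
have memE M w : (w \in [set w | M < Z w]) = (M < Z w) by apply/idP/idP; rewrite inE.
rewrite ![tail _ * _]mulrC /tail -!Ex_indic// -!ExZ; [|exact: L1_indic..].
apply/andP; split; apply: le_Ex => [||w].
- by apply: L1Z; exact: L1_indic.
- by apply: L1B; exact: L1_min.
- rewrite indicE memE /Num.min; case: ltP => h; case: ltP => h'; case: ltP => h'';
    rewrite ?mulr0 ?mulr1; lra.
- by apply: L1B; exact: L1_min.
- by apply: L1Z; exact: L1_indic.
- rewrite indicE memE /Num.min; case: ltP => h; case: ltP => h'; case: ltP => h'';
    rewrite ?mulr0 ?mulr1; lra.
Qed.

Lemma tmean_ndecr a b : 0 <= a -> a <= b -> tmean a <= tmean b.
Proof.
move=> a0 ab; have /andP[+ _] := tmean_incr _ _ a0 ab.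
rewrite -(subr_ge0 (tmean a)); apply: le_trans.
by rewrite mulr_ge0 ?tail_ge0// subr_ge0.
Qed.

End Increments.

Lemma tmean_eq_law {d} {Om : measurableType d} {R : realType}
    (P : probability Om R) (Z Z' : Om -> R) (M : R) :
  measurable_fun [set: Om] Z -> measurable_fun [set: Om] Z' ->
  (forall w, 0 <= Z w) -> (forall w, 0 <= Z' w) ->
  (forall S, measurable S -> P (Z @^-1` S) = P (Z' @^-1` S)) ->
  0 <= M -> tmean P Z M = tmean P Z' M.
Proof.
move=> mZ mZ' Z0 Z'0 ZZ' M0; congr fine.
(* The inner maximum makes [phi] nonnegative on the whole line, as [eq_law_integral] requires, and
   changes nothing at nonnegative values. *)
pose phi x : \bar R := (Num.min (Num.max 0 x) M)%:E.
have hE (Y : Om -> R) : (forall w, 0 <= Y w) ->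
    (\int[P]_w (Num.min (Y w) M)%:E = \int[P]_w phi (Y w))%E.
  by move=> Y0; apply: eq_integral => w _; rewrite /phi max_r.
rewrite hE// [RHS]hE//; apply: (eq_law_integral P Z Z' phi mZ mZ' ZZ').
  apply/measurable_EFinP; apply: measurable_minr; last exact: measurable_cst.
  by apply: measurable_maxr => //; exact: measurable_cst.
by move=> x; rewrite lee_fin le_min M0 le_max lexx.
Qed.

(** * Implicit renewal theorem *)

Section ImplicitRenewal.
Context {d : measure_display} {Om : measurableType d} {R : realType}.
Variables (P : probability Om R) (xi Z Z' : Om -> R).
Hypothesis mxi : measurable_fun [set: Om] xi.
Hypothesis LT : L1 P (fun w => expR (xi w)).
Hypothesis ET : \int[P]_w expR (xi w) = 1.
Hypothesis nonarith : ~ arithmetic_law P xi.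
Hypothesis LTx : L1 P (fun w => expR (xi w) * xi w).
Hypotheses (mZ : measurable_fun [set: Om] Z) (mZ' : measurable_fun [set: Om] Z').
Hypotheses (Z0 : forall w, 0 <= Z w) (Z'0 : forall w, 0 <= Z' w).
Hypothesis indepxZ : indep P xi Z.
Hypothesis lawZ : forall S : set R, measurable S -> P (Z @^-1` S) = P (Z' @^-1` S).
Hypothesis LD : L1 P (fun w => Z' w - expR (xi w) * Z w).

Let T w := expR (xi w).
Let p := tail P Z.
Let v := tmean P Z.
Let D := \int[P]_w (Z' w - T w * Z w).
Let m := \int[P]_w (T w * xi w).
Let G M := \int[P]_w (Num.min (Z' w) M - Num.min (T w * Z w) M).

Let T0 w : 0 < T w. Proof. exact: expR_gt0. Qed.
Let mT : measurable_fun [set: Om] T. Proof. exact: L1_measurable LT. Qed.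
Let mTZ : measurable_fun [set: Om] (fun w => T w * Z w).
Proof. exact: measurable_funM. Qed.
Let TZ0 w : 0 <= T w * Z w. Proof. by rewrite mulr_ge0 ?Z0// ltW. Qed.

Let vE M : 0 <= M -> v M = \int[P]_w Num.min (Z' w) M.
Proof.
exact: tmean_eq_law.
Qed.

Let L1_min_diff M : 0 <= M ->
  L1 P (fun w => Num.min (Z' w) M - Num.min (T w * Z w) M).
Proof. by move=> M0; apply: L1B; exact: L1_min. Qed.

Let min_lip (a b M : R) : `|Num.min a M - Num.min b M| <= `|a - b|.
Proof.
rewrite /Num.min; case: ltP => h1; case: ltP => h2 //; rewrite ler_norml;
  have := ler_norm (a - b); have := ler_norm (b - a); rewrite distrC => *;
  apply/andP; split; lra.
Qed.

Let G_bounded M : 0 <= M -> `|G M| <= \int[P]_w `|Z' w - T w * Z w|.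
Proof.
move=> M0; apply: (le_trans (le_norm_Ex _ _ (L1_min_diff _ M0))).
apply: le_Ex => [||w]; [exact/L1_norm/L1_min_diff|exact: L1_norm|exact: min_lip].
Qed.

Let G_cvg : G M @[M --> +oo] --> D.
Proof.
apply/cvg_pinftyP => u /cvgryPge uoo.
apply: (@Ex_dct _ _ _ P _ _ (fun w => `|Z' w - T w * Z w|)).
- by move=> n; apply: measurable_funB; apply: measurable_minr => //; exact: measurable_cst.
- exact: measurable_funB.
- move=> w; apply/cvgrPdist_lt => e e0.
  apply: filterS2 (uoo (Z' w)) (uoo (T w * Z w)) => n h1 h2.
  by rewrite !min_l ?subrr ?normr0.
- exact: L1_norm.
- by move=> n w; exact: min_lip.
Qed.

Let measurable_v : measurable_fun [set: R] (fun s => v (expR s)).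
Proof.
apply: nondecreasing_measurable => // s t st.
by apply: tmean_ndecr; rewrite ?expR_ge0 ?ler_expR.
Qed.

Let measurable_vxi s : measurable_fun [set: Om] (fun w => v (expR (s - xi w))).
Proof.
apply: (measurableT_comp measurable_v).
by apply: measurable_funB => //; exact: measurable_cst.
Qed.

(** By independence [T] may be frozen, and [min(T z, M) = T min(z, M / T)]. *)
Let TvE s : L1 P (fun w => T w * v (expR (s - xi w))) /\
  \int[P]_w Num.min (T w * Z w) (expR s) = \int[P]_w (T w * v (expR (s - xi w))).
Proof.
have mf : measurable_fun [set: R * R]
    (fun z => (Num.min (expR z.1 * Num.max 0 z.2) (expR s))%:E).
  apply/measurable_EFinP; apply: measurable_minr; last exact: measurable_cst.
  apply: measurable_funM.
    by apply: measurableT_comp => //; exact: measurable_fst.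
  apply: measurable_maxr; first exact: measurable_cst.
  exact: measurable_snd.
have E : (\int[P]_w (Num.min (T w * Z w) (expR s))%:E =
    \int[P]_w (T w * v (expR (s - xi w)))%:E)%E.
  have := indep_tonelli P xi Z mxi mZ indepxZ _ mf.
  rewrite (eq_integral (fun w => (Num.min (T w * Z w) (expR s))%:E)); last first.
    by move=> w _; rewrite /= max_r.
  move=> ->; last by move=> z; rewrite lee_fin le_min mulr_ge0 ?expR_ge0// le_max lexx.
  apply: eq_integral => w _ /=.
  rewrite EFinM /v /tmean L1_fineK; last by apply: L1_min => //; exact: expR_ge0.
  rewrite -ge0_integralZl//.
  - apply: eq_integral => w' _; rewrite -EFinM max_r//; congr (_%:E).
    by rewrite minr_pMr ?ltW// -expRD addrC subrK.
  - apply/measurable_EFinP; apply: measurable_minr => //; exact: measurable_cst.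
  - by move=> w' _; rewrite lee_fin le_min Z0 expR_ge0.
  - by rewrite lee_fin ltW.
split; last by congr fine.
have Lmin : L1 P (fun w => Num.min (T w * Z w) (expR s)).
  by apply: L1_min => //; exact: expR_ge0.
apply: L1_ge0.
- by apply: measurable_funM.
- move=> w; apply: mulr_ge0; [exact: ltW|apply: Ex_ge0 => w'].
  by rewrite le_min Z0 expR_ge0.
- by rewrite -E; exact: L1_lty.
Qed.

(** [v (expR s)] plays two roles: it is [E[T v (expR s)]] because [E T = 1], and [E min(Z', expR s)]
    because [Z] and [Z'] have the same law. *)
Let renewal_eq s :
  \int[P]_w (T w * (v (expR s) - v (expR (s - xi w)))) = G (expR s).
Proof.
have [h1 h2] := TvE s.
rewrite /G ExB; [|by apply: L1_min => //; exact: expR_ge0..].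
rewrite h2 -vE ?expR_ge0// -[v _ in RHS]mulr1 -ET -ExZ// -ExB//; last exact: L1Z.
by congr fine; apply: eq_integral => w _; rewrite (mulrBr (T w)) (mulrC (T w) (v (expR s))).
Qed.

Let L1_renewal s : L1 P (fun w => T w * (v (expR s) - v (expR (s - xi w)))).
Proof.
have [h1 _] := TvE s.
rewrite (_ : (fun w => _) = fun w => v (expR s) * T w - T w * v (expR (s - xi w))).
  by apply: L1B => //; exact: L1Z.
by apply/funext => w; rewrite (mulrBr (T w)) (mulrC (T w) (v (expR s))).
Qed.

(* As [E T = 1], subtracting [p M * (T M - M)] does not change the expectation in
   [renewal_eq]; concavity of [v] makes the remaining integrand nonnegative, and
   quantitatively so where [T] is large. *)
Let tail_step : exists a C, [/\ 0 < a, 0 <= C &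
  forall s, p (expR s) <= p (expR (s + a)) + C / expR s].
Proof.
have [y [suppy y0]] := tilt_support_gt0 P xi mxi LT ET nonarith.
(* On the ball of radius [y / 2] around [y] one has [xi > 2 a], so [T > expR (2 a)]: one factor
   [expR a] lifts [L] back to [M], the other is left as gain. *)
have [a aE] : exists a, a = y / 4 by exists (y / 4).
have a0 : 0 < a by lra.
pose B := xi @^-1` ball y (y / 2).
have mB : measurable B.
  by rewrite -[B]setTI; apply: mxi => //; exact: measurable_ball.
have y20 : 0 < y / 2 by lra.
pose del := fine (P B).
have del0 : 0 < del.
  by apply: fine_gt0; rewrite suppy//= -ge0_fin_numE// fin_num_measure.
have ea : 1 < expR a by rewrite expR_gt1.
pose C0 := \int[P]_w `|Z' w - T w * Z w|.
have C00 : 0 <= C0 by apply: Ex_ge0.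
exists a, (C0 / (del * (expR a - 1))); split => //.
  by rewrite divr_ge0// mulr_ge0 ?ltW// subr_gt0.
have main s : del * (expR a - 1) * expR s * (p (expR (s - a)) - p (expR s)) <= C0.
  set M := expR s; set q := p (expR (s - a)) - p M.
  have M0 : 0 < M by exact: expR_gt0.
  have q0 : 0 <= q.
    by rewrite subr_ge0; apply: tail_nonincr => //; rewrite ler_expR; lra.
  have LI : L1 P (fun w => T w * (v M - v (expR (s - xi w))) - p M * M * (T w - 1)).
    apply: L1B; first exact: (L1_renewal s).
    by apply: L1Z; apply: L1B => //; exact: L1_cst.
  have EI : \int[P]_w (T w * (v M - v (expR (s - xi w))) - p M * M * (T w - 1)) = G M.
    have L1T1 : L1 P (fun w => T w - 1) by apply: L1B => //; exact: L1_cst.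
    rewrite ExB; [|exact: (L1_renewal s)|exact: L1Z].
    rewrite ExZ// ExB//; last exact: L1_cst.
    by rewrite ET Ex_cst subrr mulr0 subr0; exact: (renewal_eq s).
  have C0G : G M <= C0 by apply: le_trans (ler_norm _) (G_bounded _ (ltW M0)).
  apply: le_trans C0G; rewrite -EI.
  rewrite (_ : _ * q = \int[P]_w (((expR a - 1) * M * q) * \1_B w)); last first.
    by rewrite ExZ ?Ex_indic//; [rewrite -/del; ring|exact: L1_indic].
  apply: le_Ex => //; first by apply: L1Z; exact: L1_indic.
  move=> w.
  set N := expR (s - xi w); have N0 : 0 < N by exact: expR_gt0.
  have TN : T w * N = M by rewrite /T /N -expRD addrC subrK.
  have -> : p M * M * (T w - 1) = T w * (p M * (M - N)) by rewrite -TN; ring.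
  rewrite -mulrBr.
  rewrite indicE; case: (boolP (w \in B)) => [|_]; last first.
    rewrite mulr0; apply: mulr_ge0; first exact: ltW.
    case: (leP N M) => NM.
      have /andP[+ _] := tmean_incr P Z mZ Z0 _ _ (ltW N0) NM; rewrite -/p -/v.
      by rewrite subr_ge0.
    have /andP[_] := tmean_incr P Z mZ Z0 _ _ (ltW M0) (ltW NM); rewrite -/p -/v.
    by move: (p M) (v M) (v N) => x1 x2 x3; lra.
  rewrite inE/= /B/= /ball/= ltr_norml => /andP[h1 h2].
  have xa : 2 * a < xi w by lra.
  set L := expR (s - a); have L0 : 0 < L by exact: expR_gt0.
  have NL : N <= L by rewrite ler_expR; lra.
  have LM : L <= M by rewrite ler_expR; lra.
  have /andP[i1 _] := tmean_incr P Z mZ Z0 _ _ (ltW L0) LM.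
  have /andP[i2 _] := tmean_incr P Z mZ Z0 _ _ (ltW N0) NL.
  rewrite -/p -/v in i1 i2; rewrite mulr1.
  (* The slope of [v] is at least [p L] on [N, L] and at least [p M] on [L, M]; compared with slope
     [p M] throughout, [N, L] gains [q * (L - N)]. *)
  apply: (@le_trans _ _ (T w * (q * (L - N)))); last first.
    apply: ler_wpM2l; first exact: ltW.
    rewrite /q -/L; move: i1 i2.
    by move: (p L) (p M) (v M) (v L) (v N) => pL pM vM vL vN; lra.
  rewrite (_ : T w * _ = q * (T w * L - M)); last by rewrite -TN; ring.
  rewrite mulrC ler_wpM2l//.
  have eaL : expR a * L = M by rewrite /L -expRD addrC subrK.
  have aT : expR a * expR a <= T w.
    by rewrite -expRD ler_expR (_ : a + a = 2 * a) ?ltW//; ring.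
  rewrite mulrBl mul1r lerD2r.
  by rewrite -eaL mulrA ler_wpM2r// ltW.
move=> s; have := main (s + a); rewrite addrK.
set r := expR a in ea *; have r0 : 0 < r - 1 by lra.
have -> : expR (s + a) = expR s * r by rewrite expRD.
have := expR_gt0 s; set M := expR s => M0 h.
have c0 : 0 < del * (r - 1) * M by rewrite !mulr_gt0.
rewrite -lerBlDl -mulrA -invfM ler_pdivlMr// mulrC.
apply: le_trans h; rewrite -subr_ge0.
rewrite (_ : _ - _ = del * (r - 1) * M * (p M - p (M * r)) * (r - 1)); last by ring.
rewrite mulr_ge0 ?(ltW r0)// mulr_ge0 ?(ltW c0)// subr_ge0.
by apply: tail_nonincr => //; rewrite ler_peMr ?ltW.
Qed.

(** [tail_step] is iterated at [s], [s + a], [s + 2 a] and so on: its errors form a geometric series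
    of ratio [expR (- a)], while the tail at the far end tends to 0 with [s] fixed. *)
Let tail_bounded : exists2 C, 0 <= C & forall s, expR s * p (expR s) <= C.
Proof.
have [a [C [a0 C0 h]]] := tail_step.
have ea : 1 < expR a by rewrite expR_gt1.
pose r := (expR a)^-1.
have r1 : r < 1 by rewrite invf_lt1// expR_gt0.
have r0 : 0 < r by rewrite invr_gt0 expR_gt0.
pose C2 := C / (1 - r).
have C20 : 0 <= C2 by rewrite divr_ge0// subr_ge0 ltW.
have C2E : C2 * r + C = C2.
  by rewrite /C2 -[X in _ + X](@divfK _ (1 - r)) ?subr_eq0 ?gt_eqF//; ring.
exists C2 => // s.
have Es0 := expR_gt0 s.
have step n : expR s * p (expR s) <= expR s * p (expR (s + a * n%:R)) + C2.
  (* The subtracted term is the unspent remainder of the geometric series, which lets the induction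
     close. *)
  suff : expR s * p (expR s) <= expR s * p (expR (s + a * n%:R)) + C2 - C2 * r ^+ n.
    have : 0 <= C2 * r ^+ n by rewrite mulr_ge0// exprn_ge0 ?ltW.
    lra.
  elim: n => [|n IH]; first by rewrite mulr0 addr0 expr0; lra.
  apply: (le_trans IH).
  have := h (s + a * n%:R).
  have -> : s + a * n%:R + a = s + a * n.+1%:R by rewrite -natr1; ring.
  set pn := p _; set pn1 := p _ => hn.
  have hn' : expR s * pn <= expR s * pn1 + C * r ^+ n.
    have -> : C * r ^+ n = expR s * (C / expR (s + a * n%:R)).
      rewrite expRD expRM_natr /r exprVn; field.
      by rewrite expf_neq0 ?gt_eqF ?expR_gt0.
    by rewrite -mulrDr ler_pM2l.
  by rewrite exprS mulrA (_ : C2 * r = C2 - C); lra.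
have lim : expR s * p (expR (s + a * n%:R)) + C2 @[n --> \oo] --> expR s * 0 + C2.
  apply: cvgD; last exact: cvg_cst.
  apply: cvgMr; apply: tail_cvg0 => //.
  apply/cvgryPge => A; exists (Num.trunc (`|A - s| / a)).+1 => // n /= hn.
  apply: (le_trans _ (le_trans _ (expR_ge1Dx _))) => //.
  have h1 : `|A - s| / a <= n%:R.
    by apply: ltW; apply: (lt_le_trans (truncnS_gt _)); rewrite ler_nat.
  move: h1; rewrite ler_pdivrMr// mulrC => h1.
  by have := ler_norm (A - s); lra.
rewrite mulr0 add0r in lim.
apply: (cvgr_to_ge lim); apply: nearW; exact: step.
Qed.


(** * Increments of the truncated mean on the logarithmic scale *)

Let phi s := v (expR s).
Let incr h s := phi (s + h) - phi s.

Let phi_ndecr s t : s <= t -> phi s <= phi t.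
Proof. by move=> st; apply: tmean_ndecr; rewrite ?expR_ge0 ?ler_expR. Qed.

Let expR_sub1_le (x : R) : expR x - 1 <= x * expR x.
Proof.
have := expR_ge1Dx (- x); rewrite expRN -(ler_pM2l (expR_gt0 x)) divff ?gt_eqF ?expR_gt0//.
lra.
Qed.

Let phi_lip : exists2 C, 0 <= C &
  forall s t, s <= t -> phi t - phi s <= C * (expR (t - s) - 1).
Proof.
have [C C0 hC] := tail_bounded; exists C => // s t st.
have est : expR s <= expR t by rewrite ler_expR.
have /andP[_ h] := tmean_incr P Z mZ Z0 _ _ (expR_ge0 s) est.
apply: (le_trans h).
have -> : expR t = expR s * expR (t - s) by rewrite -expRD addrC subrK.
rewrite (_ : _ * _ = expR s * p (expR s) * (expR (t - s) - 1)); last by rewrite /p; ring.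
by rewrite ler_wpM2r// subr_ge0 -expR0 ler_expR subr_ge0.
Qed.

Let incr_ge0 h s : 0 < h -> 0 <= incr h s.
Proof. by move=> h0; rewrite subr_ge0 phi_ndecr// lerDl ltW. Qed.

Let incr_bounded h : 0 < h -> exists K, forall s, `|incr h s| <= K.
Proof.
move=> h0; have [C C0 hC] := phi_lip; exists (C * (expR h - 1)) => s.
rewrite ger0_norm ?incr_ge0//.
have := hC s (s + h); rewrite (_ : s + h - s = h); last by ring.
by apply; rewrite lerDl ltW.
Qed.

Let incr_uc h e : 0 < h -> 0 < e -> exists2 del, 0 < del &
  forall s t, `|s - t| < del -> `|incr h s - incr h t| < e.
Proof.
move=> h0 e0; have [C C0 hC] := phi_lip.
pose E1 := expR (1 : R); have E10 : 0 < E1 by exact: expR_gt0.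
(* The summand 1 keeps [q] positive when [C = 0]; the cap 1 on the distance below bounds the
   exponential factor by [E1]. *)
pose q := 2 * C * E1 + 1.
have CE : 0 <= C * E1 by rewrite mulr_ge0// ltW.
have q0 : 0 < q by rewrite /q -mulrA; lra.
exists (Num.min 1 (e / q)) => [|s t]; first by rewrite lt_min ltr01 divr_gt0.
have phi_le x y : `|x - y| < Num.min 1 (e / q) -> `|phi x - phi y| <= C * E1 * `|x - y|.
  wlog xy : x y / x <= y.
    move=> hw; have [xy|/ltW yx] := leP x y; first exact: hw.
    by rewrite distrC [`|phi x - _|]distrC; exact: hw.
  rewrite ler0_norm ?subr_le0// ler0_norm ?subr_le0 ?phi_ndecr//.
  rewrite !opprB lt_min => /andP[d1 _].
  apply: (le_trans (hC _ _ xy)); rewrite -mulrA ler_wpM2l//.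
  apply: (le_trans (expR_sub1_le _)); rewrite mulrC ler_wpM2r ?subr_ge0//.
  by rewrite ler_expR ltW.
move=> st; have h1 := phi_le _ _ st.
have h2 : `|phi (s + h) - phi (t + h)| <= C * E1 * `|s - t|.
  have -> : s - t = s + h - (t + h) by ring.
  by apply: phi_le; rewrite (_ : s + h - (t + h) = s - t)//; ring.
move: st; rewrite lt_min => /andP[_]; rewrite ltr_pdivlMr// => h3.
have -> : incr h s - incr h t = (phi (s + h) - phi (t + h)) - (phi s - phi t).
  rewrite /incr; move: (phi (s + h)) (phi s) (phi (t + h)) (phi t) => x1 x2 x3 x4.
  by ring.
apply: (le_lt_trans (ler_normB _ _)); apply: (le_lt_trans _ h3).
apply: (le_trans (lerD h2 h1)); rewrite -subr_ge0.
by rewrite (_ : _ - _ = `|s - t|)// /q; ring.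
Qed.

Let G_expR_cvg : G (expR s) @[s --> +oo] --> D.
Proof.
apply: cvg_comp G_cvg; apply/cvgryPge => A.
apply: filterS (nbhs_pinfty_ge (num_real A)) => x Ax.
by apply: (le_trans Ax); apply: (le_trans _ (expR_ge1Dx _)); rewrite lerDr.
Qed.

(** Instances of [renewal_eq] at [s + h] and [s] are subtracted, and the common limit [D] of their
    right sides cancels. For [phi] itself the limit would be [D]. *)
Let incr_harm h : \int[P]_w (T w * (incr h s - incr h (s - xi w))) @[s --> +oo] --> (0 : R).
Proof.
rewrite [X in X @ _ --> _](_ : _ = fun s => G (expR (s + h)) - G (expR s)).
  rewrite -(subrr D); apply: cvgB; last exact: G_expR_cvg.
  by rewrite (cvg_shiftr h (fun s => G (expR s))); exact: G_expR_cvg.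
apply/funext => s; rewrite -!renewal_eq -ExB; [|exact: L1_renewal..].
apply: eq_Rintegral => w _; rewrite -mulrBr; congr (_ * _).
rewrite /incr (_ : s - xi w + h = s + h - xi w); last by ring.
rewrite /phi; move: (v _) (v _) (v _) (v _) => x1 x2 x3 x4; ring.
Qed.

(** [phi_lip] is exponential in the distance; chained over unit steps it becomes linear, and linear
    growth in [xi] is integrable with weight [T] by [LTx]. *)
Let growth : exists2 C, 0 <= C & forall s y, `|phi s - phi (s - y)| <= C * (`|y| + 1).
Proof.
have [C C0 hC] := phi_lip; pose E1 := expR (1 : R) - 1.
have E10 : 0 <= E1 by rewrite subr_ge0 -expR0 ler_expR.
have CE : 0 <= C * E1 by rewrite mulr_ge0.
exists (C * E1) => //.
have step s (n : nat) : phi (s + n%:R) - phi s <= C * E1 * n%:R.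
  elim: n => [|n IH]; first by rewrite addr0 mulr0 subrr.
  have h1 : s + n%:R <= s + n.+1%:R by rewrite lerD2l ler_nat.
  have := hC _ _ h1; rewrite (_ : s + n.+1%:R - (s + n%:R) = 1); last first.
    by rewrite -natr1; ring.
  rewrite -/E1 (_ : C * E1 * n.+1%:R = C * E1 * n%:R + C * E1); last first.
    by rewrite -natr1 mulrDr mulr1.
  by move: IH; move: (phi _) (phi _) (phi _) (C * E1) => x1 x2 x3 x4; lra.
have pos s y : 0 <= y -> `|phi (s + y) - phi s| <= C * E1 * (`|y| + 1).
  move=> y0; rewrite ger0_norm ?subr_ge0 ?phi_ndecr ?lerDl// ger0_norm//.
  have /andP[n1 n2] := truncn_itv y0.
  apply: (@le_trans _ _ (C * E1 * (Num.trunc y).+1%:R)); last first.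
    by rewrite ler_wpM2l// -natr1 lerD2r.
  apply: le_trans (step s _); rewrite lerD2r phi_ndecr// lerD2l.
  exact: ltW.
move=> s y; have [y0|/ltW y0] := leP 0 y.
  by have := pos (s - y) y y0; rewrite subrK.
have := pos s (- y); rewrite oppr_ge0 normrN distrC; exact.
Qed.

(** * The value of a limiting increment *)

Section Identification.
Variables (h eta : R) (u : R^nat).
Hypothesis h0 : 0 < h.
Hypothesis incr_cvg : forall y, incr h (u n - y) @[n --> \oo] --> eta.

Let eta0 : 0 <= eta.
Proof.
by apply: (cvgr_to_ge (incr_cvg 0)); apply: nearW => n; exact: incr_ge0.
Qed.

Let drop_cvg z (k : nat) :
  phi (u n - z) - phi (u n - z - k%:R * h) @[n --> \oo] --> k%:R * eta.
Proof.
elim: k => [|k IH].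
  rewrite !mul0r [X in X @ _ --> _](_ : _ = fun=> 0); first exact: cvg_cst.
  by apply/funext => n; rewrite subr0 subrr.
rewrite [X in X @ _ --> _](_ : _ = fun n => (phi (u n - z) - phi (u n - z - k%:R * h)) +
    incr h (u n - (z + k.+1%:R * h))).
  have -> : k.+1%:R * eta = k%:R * eta + eta by rewrite -natr1 mulrDl mul1r.
  by apply: cvgD; [exact: IH|exact: incr_cvg].
apply/funext => n; rewrite /incr -natr1.
have -> : u n - (z + (k%:R + 1) * h) + h = u n - z - k%:R * h by ring.
have -> : u n - (z + (k%:R + 1) * h) = u n - z - (k%:R + 1) * h by ring.
by move: (phi _) (phi _) (phi _) => x1 x2 x3; ring.
Qed.

(** By monotonicity a drop over [x >= 0] lies between the drops over [k] and [k + 1] steps of length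
    [h], with [k] the integer part of [x / h]. This uncertainty of one step is the origin of [- 1]
    and [+ 1]. *)
Let drop_near y e : 0 < e -> \forall n \near \oo,
  eta * (y / h - 1) - e <= phi (u n) - phi (u n - y) <= eta * (y / h + 1) + e.
Proof.
move=> e0.
have pos z x : 0 <= x -> \forall n \near \oo,
    eta * (x / h - 1) - e <= phi (u n - z) - phi (u n - z - x) <= eta * (x / h + 1) + e.
  move=> x0; have xh0 : 0 <= x / h by rewrite divr_ge0// ltW.
  have /andP[] := truncn_itv xh0; set k := Num.trunc _ => k1 k2.
  have /cvgrPdist_le/(_ e e0) c1 := drop_cvg z k.
  have /cvgrPdist_le/(_ e e0) c2 := drop_cvg z k.+1.
  apply: filterS2 c1 c2 => n /ler_normlP[a1 a2] /ler_normlP[b1 b2].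
  have m1 : phi (u n - z - k.+1%:R * h) <= phi (u n - z - x).
    by apply: phi_ndecr; rewrite lerD2l lerN2 -ler_pdivrMr// ltW.
  have m2 : phi (u n - z - x) <= phi (u n - z - k%:R * h).
    by apply: phi_ndecr; rewrite lerD2l lerN2 -ler_pdivlMr.
  have l1 : (x / h - 1) * eta <= k%:R * eta.
    by rewrite ler_wpM2r// lerBlDr natr1 ltW.
  have l2 : k.+1%:R * eta <= (x / h + 1) * eta.
    by rewrite ler_wpM2r// -natr1 lerD2r.
  rewrite mulrC [eta * (_ + _)]mulrC; move: a1 a2 b1 b2 m1 m2 l1 l2.
  move: (phi _) (phi _) (phi _) (phi _) (_ * eta) (_ * eta) (_ * eta) (_ * eta).
  by move=> x1 x2 x3 x4 x5 x6 x7 x8 *; apply/andP; split; lra.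
have [y0|/ltW y0] := leP 0 y.
  by apply: filterS (pos 0 y y0) => n; rewrite subr0.
(* For [y < 0] the endpoints exchange roles: the drop has length [- y] and starts at [u n - y]. *)
have y0' : 0 <= - y by rewrite oppr_ge0.
apply: filterS (pos y _ y0') => n.
rewrite opprK subrK mulNr; move: (phi _) (phi _) => x1 x2 /andP[a1 a2].
by apply/andP; split; lra.
Qed.

Let psi n w := phi (u n) - phi (u n - xi w).

Let LTaff a b : L1 P (fun w => T w * (a * `|xi w| + b)).
Proof.
rewrite (_ : (fun w => _) = fun w => a * `|T w * xi w| + b * T w).
  by apply: L1D; [apply/L1Z/L1_norm|apply: L1Z].
by apply/funext => w; rewrite normrM [`|T w|]gtr0_norm//; ring.
Qed.

Let LTaff' a b : L1 P (fun w => T w * (a * xi w + b)).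
Proof.
rewrite (_ : (fun w => _) = fun w => a * (T w * xi w) + b * T w).
  by apply: L1D; apply: L1Z.
by apply/funext => w; ring.
Qed.

Let ETaff a b : \int[P]_w (T w * (a * xi w + b)) = a * m + b.
Proof.
rewrite (_ : (fun w => _) = fun w => a * (T w * xi w) + b * T w).
  by rewrite ExD ?ExZ ?ET ?mulr1//; exact: L1Z.
by apply/funext => w; ring.
Qed.

(* [F] is either [psi n - (upper affine bound)] or [(lower affine bound) - psi n]. *)
Let excess_cvg0 (F : nat -> Om -> R) a b : 0 <= a -> 0 <= b ->
  (forall n, measurable_fun [set: Om] (F n)) ->
  (forall n w, `|F n w| <= a * `|xi w| + b) ->
  (forall w e, 0 < e -> \forall n \near \oo, F n w <= e) ->
  \int[P]_w (T w * Num.max 0 (F n w)) @[n --> \oo] --> (0 : R).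
Proof.
move=> a0 b0 mF Fle F0; rewrite -[X in _ --> X](Ex_cst P 0).
apply: (@Ex_dct _ _ _ P _ _ (fun w => T w * (a * `|xi w| + b))).
- move=> n; apply: measurable_funM => //.
  by apply: measurable_maxr => //; exact: measurable_cst.
- exact: measurable_cst.
- move=> w; rewrite -[X in _ --> X](mulr0 (T w)).
  apply: cvgMr; apply/cvgrPdist_le => e e0.
  apply: filterS (F0 w e e0) => n hn.
  by rewrite sub0r normrN ger0_norm ?le_max ?lexx// ge_max hn ltW.
- exact: LTaff.
- move=> n w; rewrite normrM gtr0_norm// ler_wpM2l ?(ltW (T0 w))//.
  apply: le_trans (Fle n w).
  by rewrite /Num.max; case: ltP => // _; rewrite normr0.
Qed.

Hypothesis uoo : u @ \oo --> +oo.

(** [drop_near] holds for each [w] only from some [n] on, so it cannot be integrated directly.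
    Correcting by the excess over the affine bound gives an inequality at every [w], and the mean of
    the excess vanishes by [excess_cvg0]. *)
Lemma increment_limit_bounds : eta * (m / h - 1) <= D <= eta * (m / h + 1).
Proof.
have [C C0 hC] := growth.
have Gu : G (expR (u n)) @[n --> \oo] --> D by exact: (cvg_comp _ _ uoo G_expR_cvg).
have mpsi n : measurable_fun [set: Om] (psi n).
  by apply: measurable_funB; [exact: measurable_cst|exact: measurable_vxi].
have maff a b : measurable_fun [set: Om] (fun w => a * xi w + b).
  apply: measurable_funD; last exact: measurable_cst.
  by apply: measurable_funM => //; exact: measurable_cst.
have Lpsi n : L1 P (fun w => T w * psi n w) by exact: L1_renewal.
have eh0 : 0 <= eta / h by rewrite divr_ge0// ltW.
have LTmax (F : Om -> R) (a b : R) : measurable_fun [set: Om] F ->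
    (forall w, `|F w| <= a * `|xi w| + b) -> L1 P (fun w => T w * Num.max 0 (F w)).
  move=> mF hF; apply: (L1_le P _ _ _ (LTaff a b)).
    apply: measurable_funM => //.
    by apply: measurable_maxr => //; exact: measurable_cst.
  move=> w; rewrite normrM gtr0_norm// ler_wpM2l ?(ltW (T0 w))//.
  apply: le_trans (hF w).
  by rewrite /Num.max; case: ltP => // _; rewrite normr0.
have aff_norm (b : R) w : `|eta / h * xi w + b| <= eta / h * `|xi w| + `|b|.
  by apply: (le_trans (ler_normD _ _)); rewrite normrM [`|eta / h|]ger0_norm.
have psi_norm n w : `|psi n w| <= C * `|xi w| + C.
  by apply: (le_trans (hC _ _)); rewrite mulrDr mulr1.
have ae : `|eta| = eta by rewrite ger0_norm.
apply/andP; split.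
- pose F n w := (eta / h * xi w + - eta) - psi n w.
  have mF n : measurable_fun [set: Om] (F n) by exact: measurable_funB.
  have Fle n w : `|F n w| <= (eta / h + C) * `|xi w| + (eta + C).
    apply: (le_trans (ler_normB _ _)).
    by have := aff_norm (- eta) w; have := psi_norm n w; rewrite normrN ae; lra.
  have lim0 : \int[P]_w (T w * Num.max 0 (F n w)) @[n --> \oo] --> (0 : R).
    apply: (excess_cvg0 _ (eta / h + C) (eta + C)) => //; [exact: addr_ge0..|].
    move=> w e e0; apply: filterS (drop_near (xi w) e e0) => n /andP[+ _].
    by rewrite /F /psi; move: (phi _) (phi _) => x1 x2; lra.
  have lim1 : G (expR (u n)) + \int[P]_w (T w * Num.max 0 (F n w)) @[n --> \oo] --> D.
    by rewrite -(addr0 D); exact: cvgD.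
  apply: (cvgr_to_ge lim1); apply: nearW => n /=.
  rewrite -renewal_eq -ExD; [|exact: L1_renewal|exact: LTmax (mF n) (Fle n)].
  rewrite (_ : eta * _ = eta / h * m + - eta); last by ring.
  rewrite -ETaff; apply: le_Ex => [||w].
  + exact: LTaff'.
  + by apply: L1D; [exact: L1_renewal|exact: LTmax (mF n) (Fle n)].
  + rewrite -mulrDr ler_pM2l//; have : F n w <= Num.max 0 (F n w) by rewrite le_max lexx orbT.
    rewrite {1}/F /psi /phi; move: (v _) (v _) (Num.max 0 _) => x1 x2 x3; lra.
- pose F n w := psi n w - (eta / h * xi w + eta).
  have mF n : measurable_fun [set: Om] (F n) by exact: measurable_funB.
  have Fle n w : `|F n w| <= (eta / h + C) * `|xi w| + (eta + C).
    apply: (le_trans (ler_normB _ _)).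
    by have := aff_norm eta w; have := psi_norm n w; rewrite ae; lra.
  have lim0 : \int[P]_w (T w * Num.max 0 (F n w)) @[n --> \oo] --> (0 : R).
    apply: (excess_cvg0 _ (eta / h + C) (eta + C)) => //; [exact: addr_ge0..|].
    move=> w e e0; apply: filterS (drop_near (xi w) e e0) => n /andP[_].
    by rewrite /F /psi; move: (phi _) (phi _) => x1 x2; lra.
  have lim1 : G (expR (u n)) - \int[P]_w (T w * Num.max 0 (F n w)) @[n --> \oo] --> D.
    by rewrite -(subr0 D); exact: cvgB.
  apply: (cvgr_to_le lim1); apply: nearW => n /=.
  rewrite -renewal_eq -ExB; [|exact: L1_renewal|exact: LTmax (mF n) (Fle n)].
  rewrite (_ : eta * _ = eta / h * m + eta); last by ring.
  rewrite -ETaff; apply: le_Ex => [||w].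
  + by apply: L1B; [exact: L1_renewal|exact: LTmax (mF n) (Fle n)].
  + exact: LTaff'.
  + rewrite -mulrBr ler_pM2l//; have : F n w <= Num.max 0 (F n w) by rewrite le_max lexx orbT.
    rewrite {1}/F /psi /phi; move: (v _) (v _) (Num.max 0 _) => x1 x2 x3; lra.
Qed.

End Identification.

Let m_gt0 : 0 < m. Proof. exact: tilt_mean_gt0. Qed.

(** For [h < m] the second conjunct bounds the limsup from above by [D h / (m - h)]. *)
Let incr_limsup h : 0 < h -> exists eta, [/\ 0 <= eta, eta * (m / h - 1) <= D &
  forall e, 0 < e -> exists N, forall s, N <= s -> incr h s <= eta + e].
Proof.
move=> h0; have [K hK] := incr_bounded _ h0.
have [eta [u [uoo fu f_le]]] := limsup_seq (incr h) K hK.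
have sp y : incr h (u n - y) @[n --> \oo] --> eta.
  apply: (spread P xi mxi LT ET nonarith (incr h) K hK _ (incr_harm h)) => //.
  by move=> e e0; exact: incr_uc.
exists eta; split => //.
  by apply: (cvgr_to_ge fu); apply: nearW => n; exact: incr_ge0.
by have /andP[] := increment_limit_bounds _ _ _ h0 sp uoo.
Qed.

(** The limsup argument for [- incr h], which is also bounded, uniformly continuous and
    asymptotically harmonic; the liminf is then at least [D h / (m + h)]. *)
Let incr_liminf h : 0 < h -> exists eta, D <= eta * (m / h + 1) /\
  forall e, 0 < e -> exists N, forall s, N <= s -> eta - e <= incr h s.
Proof.
move=> h0; have [K hK] := incr_bounded _ h0.
have hK' s : `|- incr h s| <= K by rewrite normrN.
have [eta [u [uoo fu f_le]]] := limsup_seq (fun s => - incr h s) K hK'.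
have sp y : - incr h (u n - y) @[n --> \oo] --> eta.
  apply: (spread P xi mxi LT ET nonarith (fun s => - incr h s) K hK') => //.
    move=> e e0; have [del del0 hdel] := incr_uc _ _ h0 e0; exists del => // s t st.
    by rewrite -opprD normrN; exact: hdel.
  rewrite [X in X @ _ --> _](_ : _ = fun s =>
      - \int[P]_w (T w * (incr h s - incr h (s - xi w)))).
    by rewrite -oppr0; apply: cvgN; exact: incr_harm.
  apply/funext => s; rewrite -ExN.
    apply: eq_Rintegral => w _; rewrite -mulrN; congr (_ * _).
    by move: (incr h s) (incr h _) => x1 x2; ring.
  rewrite (_ : (fun w => _) = fun w => T w * (phi (s + h) - phi (s + h - xi w)) -
      T w * (phi s - phi (s - xi w))).
    by apply: L1B; exact: L1_renewal.
  apply/funext => w; rewrite -mulrBr; congr (_ * _).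
  rewrite /incr (_ : s - xi w + h = s + h - xi w); last by ring.
  by move: (phi _) (phi _) (phi _) (phi _) => x1 x2 x3 x4; ring.
have sp' y : incr h (u n - y) @[n --> \oo] --> - eta.
  rewrite [X in X @ _ --> _](_ : _ = fun n => - - incr h (u n - y)).
    by apply: cvgN; exact: sp.
  by apply/funext => n; rewrite opprK.
exists (- eta); split.
  by have /andP[] := increment_limit_bounds _ _ _ h0 sp' uoo.
move=> e e0; have [N hN] := f_le e e0; exists N => s /hN; lra.
Qed.

(** No sign is visible in the definition of [D]. The step [h = m / 2] makes [m / h - 1] equal to 1,
    so [D] dominates a nonnegative limsup. *)
Lemma renewal_defect_ge0 : 0 <= D.
Proof.
have h0 : 0 < m / 2 by rewrite divr_gt0.
have [eta [eta0 h1 _]] := incr_limsup _ h0.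
apply: (le_trans _ h1); rewrite mulr_ge0// (_ : m / (m / 2) = 2); first by lra.
by field; rewrite gt_eqF.
Qed.

Let small_step e : 0 < e -> exists h, [/\ 0 < h, h < m,
  (1 + h) * (D / (m - h)) <= D / m + e & D / m - e <= (1 - h) * (D / (m + h))].
Proof.
move=> e0; have D0 := renewal_defect_ge0; have m0 := m_gt0.
move: m0 D0; move: D m => D' m' m0 D0.
(* The two errors are [h (m' + 1) D'] divided by [m' (m' - h)] and by [m' (m' + h)]; [b] brings both
   below [e]. Using [D' + 1] avoids division by 0. *)
pose b := e * (m' * m') / (2 * (m' + 1) * (D' + 1)).
have c0 : 0 < 2 * (m' + 1) * (D' + 1) by rewrite !mulr_gt0//; lra.
have b0 : 0 < b by rewrite divr_gt0// !mulr_gt0.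
exists (Num.min (m' / 2) b); set h := Num.min _ _.
have h0 : 0 < h by rewrite lt_min b0 divr_gt0.
have hm : h <= m' / 2 by rewrite ge_min lexx.
have hb : h <= b by rewrite ge_min lexx orbT.
have key : 2 * h * (m' + 1) * D' <= e * (m' * m').
  have : h * (2 * (m' + 1) * (D' + 1)) <= e * (m' * m') by rewrite -ler_pdivlMr.
  apply: le_trans; rewrite (_ : 2 * h * _ * _ = h * (2 * (m' + 1) * D')); last by ring.
  by rewrite ler_pM2l// ler_pM2l ?lerDl// mulr_gt0//; lra.
have hmm : h < m' by lra.
split => //.
- rewrite -subr_ge0 (_ : _ - _ = (e * (m' * (m' - h)) - h * (m' + 1) * D') / (m' * (m' - h))).
    apply: divr_ge0; last by rewrite mulr_ge0//; lra.
    rewrite subr_ge0.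
    apply: (@le_trans _ _ (e * (m' * (m' / 2)))); first by lra.
    by rewrite ler_pM2l// ler_pM2l//; lra.
  by field; apply/andP; split; apply: lt0r_neq0; lra.
- rewrite -subr_ge0 (_ : _ - _ = (e * (m' * (m' + h)) - h * (m' + 1) * D') / (m' * (m' + h))).
    apply: divr_ge0; last by rewrite mulr_ge0//; lra.
    rewrite subr_ge0.
    apply: (@le_trans _ _ (e * (m' * (m' / 2)))); first by lra.
    by rewrite ler_pM2l// ler_pM2l//; lra.
  by field; apply/andP; split; apply: lt0r_neq0; lra.
Qed.

Let tail_limit_log e : 0 < e -> exists N, forall s, N <= s ->
  D / m - e <= expR s * p (expR s) <= D / m + e.
Proof.
move=> e0; have e20 : 0 < e / 2 by lra.
have [h [h0 hm up lo]] := small_step _ e20.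
have eh1 : 0 < expR h - 1 by rewrite subr_gt0 expR_gt1.
(* As [p] is nonincreasing, an increment brackets [expR s * p (expR s)]. On the left the factor
   [1 - expR (- h)] is replaced by the smaller [h / (1 + h)]. *)
have incrP s : expR (s + h) * p (expR (s + h)) * (h / (1 + h)) <= incr h s
    <= expR s * p (expR s) * (expR h - 1).
  have le : expR s <= expR (s + h) by rewrite ler_expR lerDl ltW.
  have /andP[i1 i2] := tmean_incr P Z mZ Z0 _ _ (expR_ge0 s) le.
  apply/andP; split.
    apply: le_trans i1; rewrite -/p [expR _ * p _]mulrC -mulrA ler_wpM2l ?tail_ge0//.
    rewrite expRD -mulrA -[X in _ <= _ - X]mulr1 -mulrBr ler_wpM2l ?expR_ge0//.
    rewrite mulrA ler_pdivrMr; last by lra.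
    by have := expR_ge1Dx h; lra.
  apply: (le_trans i2); rewrite expRD -/p le_eqVlt; apply/orP; left; apply/eqP; ring.
have [eta1 [eta10 U1 U2]] := incr_limsup _ h0.
have [eta2 [L1' L2]] := incr_liminf _ h0.
have e10 : 0 < e / 2 * (h / (1 + h)) by rewrite mulr_gt0// divr_gt0//; lra.
have e20' : 0 < e / 2 * (expR h - 1) by rewrite mulr_gt0.
have [N1 hN1] := U2 _ e10; have [N2 hN2] := L2 _ e20'.
exists (Num.max (N1 + h) N2) => s; rewrite ge_max => /andP[s1 s2].
have mh0 : 0 < m - h by rewrite subr_gt0.
have m0 := m_gt0.
apply/andP; split.
- have /andP[_ i] := incrP s; have := hN2 _ s2.
  have E : D / (m / h + 1) <= eta2.
    by rewrite ler_pdivrMr// addr_gt0// divr_gt0.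
  move=> j; rewrite -(ler_pM2r eh1); apply: le_trans i; apply: le_trans j.
  suff : (D / m - e / 2) * (expR h - 1) <= D / (m / h + 1) by lra.
  apply: (@le_trans _ _ ((1 - h) * (D / (m + h)) * (expR h - 1))).
    by rewrite ler_pM2r.
  have -> : D / (m / h + 1) = D / (m + h) * h.
    by field; apply/andP; split; apply: lt0r_neq0 => //; exact: addr_gt0.
  rewrite mulrAC mulrC ler_wpM2l//.
    by rewrite divr_ge0 ?renewal_defect_ge0// ltW// addr_gt0.
  (* What remains is [(1 - h) (expR h - 1) <= h]: trivial for [h > 1], otherwise from
     [1 - h <= expR (- h)] and [expR h - 1 <= h expR h]. *)
  have [h1|h1] := leP h 1; last first.
    apply: (@le_trans _ _ 0); last exact: ltW.
    by apply: mulr_le0_ge0; [lra|exact: ltW].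
  apply: (@le_trans _ _ (expR (- h) * (h * expR h))).
    apply: ler_pM; [by lra|exact: ltW| |exact: expR_sub1_le].
    by have := expR_ge1Dx (- h).
  by rewrite expRN mulrCA mulVf ?mulr1// gt_eqF ?expR_gt0.
- have /andP[i _] := incrP (s - h); rewrite subrK in i.
  have s1' : N1 <= s - h by rewrite lerBrDr.
  have j := le_trans i (hN1 _ s1').
  have hh0 : 0 < h / (1 + h) by rewrite divr_gt0//; lra.
  rewrite -(ler_pM2r hh0); apply: (le_trans j).
  suff : eta1 <= (D / m + e / 2) * (h / (1 + h)) by lra.
  apply: (@le_trans _ _ ((1 + h) * (D / (m - h)) * (h / (1 + h)))); last by rewrite ler_pM2r.
  have -> : (1 + h) * (D / (m - h)) * (h / (1 + h)) = D / (m / h - 1).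
    field; apply/and3P; split; apply: lt0r_neq0 => //; lra.
  rewrite ler_pdivlMr// subr_gt0 ltr_pdivlMr// mul1r//.
Qed.

Theorem implicit_renewal :
  M * tail P Z M @[M --> +oo] --> \int[P]_w (Z' w - expR (xi w) * Z w) /
    \int[P]_w (expR (xi w) * xi w).
Proof.
apply/cvgrPdist_le => e e0; have [N hN] := tail_limit_log _ e0.
apply: filterS (nbhs_pinfty_ge (num_real (expR N))) => M MN.
have M0 : 0 < M by apply: lt_le_trans MN; exact: expR_gt0.
have lnM : N <= ln M by rewrite -ler_expR lnK.
have := hN _ lnM; rewrite lnK// -/D -/m -/p distrC ler_norml => /andP[a1 a2].
by apply/andP; split; lra.
Qed.

End ImplicitRenewal.

(** * Inequalities for powers *)

(** After rounding the exponent up, this is the chord of the convex function [(1 + r)^n] over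
    [0, 1]; its exact slope [2^n - 1] passes through the induction. *)
Lemma powR_1D_le {R : realType} (al r : R) (n : nat) : al <= n%:R ->
  0 <= r <= 1 -> (1 + r) `^ al <= 1 + 2 ^+ n * r.
Proof.
move=> aln /andP[r0 r1].
have r10 : 1 <= 1 + r by rewrite lerDl.
apply: (le_trans (ler_powR r10 aln)); rewrite powR_mulrn; last by lra.
suff : (1 + r) ^+ n <= 1 + (2 ^+ n - 1) * r by lra.
elim: n {aln} => [|n IH]; first by rewrite !expr0 subrr mul0r addr0.
have p1 : 1 <= 2 ^+ n :> R by rewrite exprn_ege1// ler1n.
rewrite exprS; apply: (@le_trans _ _ ((1 + r) * (1 + (2 ^+ n - 1) * r))).
  by rewrite ler_wpM2l//; lra.
rewrite exprS -subr_ge0 (_ : _ - _ = (2 ^+ n - 1) * (r * (1 - r))); last by ring.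
by rewrite !mulr_ge0 ?subr_ge0.
Qed.

Lemma powR_1B_ge {R : realType} (al r : R) (n : nat) : 0 < al -> al <= n%:R ->
  0 <= r <= 1 -> 1 - n%:R * r <= (1 - r) `^ al.
Proof.
move=> al0 aln /andP[r0]; rewrite le_eqVlt => /predU1P[->|r1].
  rewrite mulr1 subrr powR0 ?gt_eqF// subr_le0.
  have : 0 < n%:R :> R by apply: lt_le_trans aln.
  by rewrite ltr0n -(ler_nat R).
have rb : 0 < 1 - r <= 1 by rewrite subr_gt0 r1 gerBl.
apply: (le_trans _ (ger_powR rb aln)); rewrite powR_mulrn; last by lra.
elim: n {aln} => [|n IH]; first by rewrite mul0r subr0 expr0.
rewrite exprS; apply: (@le_trans _ _ ((1 - r) * (1 - n%:R * r))).
  rewrite -subr_ge0 -natr1 (_ : _ - _ = n%:R * (r * r)); last by ring.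
  by rewrite !mulr_ge0.
by rewrite ler_wpM2l// subr_ge0 ltW.
Qed.

(** The aim is an error of order [be], not [al], in [a]. For [b <= a] put [r = b / a]: the error is
    of order [a^al r], and [r <= r^(al - be)] because [al - be < 1]. For [b > a] everything is of
    order [b^al]. *)
Lemma powR_dist_le {R : realType} (al be : R) : al - 1 < be -> 0 < be -> be < al ->
  exists2 K, 0 <= K & forall a b x : R, 0 <= a -> 0 <= b -> 0 <= x ->
    `|x - a| <= b ->
    `|x `^ al - a `^ al| <= K * (b `^ al + b `^ (al - be) * a `^ be).
Proof.
move=> ab1 be0 ab; have al0 : 0 < al by exact: lt_trans ab.
pose n := (Num.trunc al).+1; have aln : al <= n%:R by exact/ltW/truncnS_gt.
exists (2 ^+ n) => [|a b x a0 b0 x0]; first exact: exprn_ge0.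
have n2 : n%:R <= 2 ^+ n :> R by rewrite -natrX ler_nat ltnW// ltn_expl.
have n21 : 1 <= 2 ^+ n :> R by rewrite exprn_ege1// ler1n.
rewrite ler_norml => /andP[d1 d2].
have pos : 0 <= b `^ (al - be) * a `^ be by rewrite mulr_ge0 ?powR_ge0.
have [ba|ab'] := leP b a; last first.
  have xb : x `^ al <= 2 ^+ n * b `^ al.
    apply: (@le_trans _ _ ((2 * b) `^ al)).
      by apply: ge0_ler_powR; rewrite ?nnegrE ?(ltW al0)//; lra.
    rewrite powRM// ler_wpM2r ?powR_ge0// -powR_mulrn// ler_powR//.
    by lra.
  have ab2 : a `^ al <= 2 ^+ n * b `^ al.
    apply: (@le_trans _ _ (b `^ al)); last by rewrite ler_peMl ?powR_ge0.
    by apply: ge0_ler_powR; rewrite ?nnegrE ?(ltW al0)//; lra.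
  have := powR_ge0 x al; have := powR_ge0 a al.
  have : 0 <= 2 ^+ n * (b `^ (al - be) * a `^ be) by rewrite mulr_ge0// exprn_ge0.
  by rewrite mulrDr ler_norml => *; apply/andP; split; lra.
have [a0'|a0'] := eqVneq a 0.
  have b0' : b = 0 by apply/eqP; rewrite eq_le b0 -a0' ba.
  have -> : x = a by lra.
  by rewrite subrr normr0 mulr_ge0 ?exprn_ge0// addr_ge0 ?powR_ge0.
have {}a0' : 0 < a by rewrite lt0r a0'.
pose r := b / a.
have r0 : 0 <= r by rewrite divr_ge0.
have r1 : r <= 1 by rewrite ler_pdivrMr// mul1r.
have bE : b = a * r by rewrite /r mulrC divfK ?gt_eqF.
have rle : a `^ al * r <= b `^ (al - be) * a `^ be.
  rewrite bE powRM// mulrAC -powRD; last by rewrite (gt_eqF a0') implybT.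
  rewrite subrK ler_wpM2l ?powR_ge0//.
  have [->|rn0] := eqVneq r 0; first by rewrite powR_ge0.
  by apply: ger1_powR; [rewrite lt0r rn0 r0 r1|lra].
have up : x `^ al <= a `^ al * (1 + 2 ^+ n * r).
  apply: (@le_trans _ _ ((a * (1 + r)) `^ al)).
    by apply: ge0_ler_powR; rewrite ?nnegrE ?(ltW al0)//; [rewrite mulr_ge0//; lra|lra].
  rewrite powRM//; last by lra.
  by rewrite ler_wpM2l ?powR_ge0// powR_1D_le ?r0.
have lo : a `^ al * (1 - n%:R * r) <= x `^ al.
  apply: (@le_trans _ _ ((a * (1 - r)) `^ al)); last first.
    by apply: ge0_ler_powR; rewrite ?nnegrE ?(ltW al0)//; [rewrite mulr_ge0//; lra|lra].
  rewrite powRM//; last by lra.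
  by rewrite ler_wpM2l ?powR_ge0// powR_1B_ge ?r0.
have k1 : 2 ^+ n * (a `^ al * r) <= 2 ^+ n * (b `^ (al - be) * a `^ be).
  by rewrite ler_wpM2l// exprn_ge0.
have k2 : n%:R * (a `^ al * r) <= 2 ^+ n * (a `^ al * r).
  by rewrite ler_wpM2r// mulr_ge0// powR_ge0.
have k3 : 0 <= 2 ^+ n * b `^ al by rewrite mulr_ge0 ?exprn_ge0 ?powR_ge0.
move: up lo k1 k2 k3; move: (2 ^+ n) (n%:R) (_ * a `^ be) (b `^ al) (a `^ al) (x `^ al).
by move=> N n' y1 y2 y3 y4 *; rewrite ler_norml; apply/andP; split; lra.
Qed.

(** The factor of [a^be] can be taken close enough to 1 not to spoil [E A^be < 1]. Either [b] is at
    most a small fraction [e] of [a], or [a] is below [b / e]. *)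
Lemma powR_add_le {R : realType} (be del : R) : 0 < be -> 0 < del ->
  exists2 C, 0 <= C & forall a b : R, 0 <= a -> 0 <= b ->
    (a + b) `^ be <= (1 + del) * a `^ be + C * b `^ be.
Proof.
move=> be0 del0.
pose n := (Num.trunc be).+1; have ben : be <= n%:R by exact/ltW/truncnS_gt.
have n20 : 0 < 2 ^+ n :> R by rewrite exprn_gt0.
pose e := Num.min 1 (del / 2 ^+ n).
have e0 : 0 < e by rewrite lt_min ltr01 divr_gt0.
have e1 : e <= 1 by rewrite ge_min lexx.
have e2 : 2 ^+ n * e <= del.
  by rewrite mulrC -ler_pdivlMr// ge_min lexx orbT.
exists ((e^-1 + 1) `^ be); first exact: powR_ge0.
move=> a b a0 b0; have [bea|abe] := leP b (e * a).
  apply: (@le_trans _ _ ((a * (1 + e)) `^ be)).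
    apply: ge0_ler_powR; rewrite ?nnegrE ?(ltW be0)//.
    - by rewrite addr_ge0.
    - by rewrite mulr_ge0//; lra.
    - by rewrite mulrDr mulr1 lerD2l mulrC.
  rewrite powRM//; last by lra.
  apply: (@le_trans _ _ (a `^ be * (1 + del))); last first.
    by rewrite mulrC lerDl mulr_ge0 ?powR_ge0.
  rewrite ler_wpM2l ?powR_ge0//.
  apply: (le_trans (powR_1D_le be e n ben _)); first by rewrite (ltW e0) e1.
  by rewrite lerD2l.
apply: (@le_trans _ _ (((e^-1 + 1) * b) `^ be)).
  apply: ge0_ler_powR; rewrite ?nnegrE ?(ltW be0)//.
  - by rewrite addr_ge0.
  - by rewrite mulr_ge0// addr_ge0// invr_ge0 ltW.
  - by rewrite mulrDl mul1r lerD2r mulrC ler_pdivlMr// mulrC ltW.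
rewrite powRM//; last by rewrite addr_ge0// invr_ge0 ltW.
by rewrite lerDr mulr_ge0 ?powR_ge0//; lra.
Qed.

Lemma powR_young {R : realType} (al be a b : R) : 0 < be -> be < al ->
  0 <= a -> 0 <= b -> b `^ (al - be) * a `^ be <= b `^ al + a `^ al.
Proof.
move=> be0 ab a0 b0.
have ab0 : 0 < al - be by rewrite subr_gt0.
have al0 : 0 < al by exact: lt_trans ab.
have E c : 0 <= c -> c `^ (al - be) * c `^ be = c `^ al.
  by move=> c0; rewrite -powRD subrK// gt_eqF.
have [ba|ba] := leP b a.
  apply: (@le_trans _ _ (a `^ al)); last by rewrite lerDr powR_ge0.
  rewrite -(E a)// ler_wpM2r ?powR_ge0//.
  by apply: ge0_ler_powR; rewrite ?nnegrE ?(ltW ab0).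
apply: (@le_trans _ _ (b `^ al)); last by rewrite lerDl powR_ge0.
rewrite -(E b)// ler_wpM2l ?powR_ge0//.
by apply: ge0_ler_powR; rewrite ?nnegrE ?(ltW be0) ?(ltW ba).
Qed.

Lemma powR_le_1D {R : realType} (al be a : R) : 0 < be -> be < al -> 0 <= a ->
  a `^ be <= 1 + a `^ al.
Proof.
move=> be0 ab a0; have := powR_young al be a 1 be0 ab a0 ler01.
by rewrite !powR1 mul1r.
Qed.

(** * Moments of contractive recursions *)

Section ContractiveMoment.
Context {d : measure_display} {Om : measurableType d} {R : realType}.
Variables (P : probability Om R) (Y Y' S b : Om -> R).
Hypotheses (mY : measurable_fun [set: Om] Y) (mY' : measurable_fun [set: Om] Y').
Hypotheses (Y0 : forall w, 0 <= Y w) (Y'0 : forall w, 0 <= Y' w).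
Hypotheses (S0 : forall w, 0 < S w) (b0 : forall w, 0 <= b w).
Hypothesis indepSY : indep P S Y.
Hypothesis lawY : forall E : set R, measurable E -> P (Y @^-1` E) = P (Y' @^-1` E).
Hypotheses (LS : L1 P S) (ES : \int[P]_w S w < 1) (Lb : L1 P b).
Hypothesis Y'_le : {ae P, forall w, Y' w <= S w * Y w + b w}.

Let mS : measurable_fun [set: Om] S. Proof. exact: L1_measurable LS. Qed.
Let rho := \int[P]_w S w.
Let beta := \int[P]_w b w.
Let u := tmean P Y.

Let mSY : measurable_fun [set: Om] (fun w => S w * Y w).
Proof. exact: measurable_funM. Qed.

Let SY0 w : 0 <= S w * Y w. Proof. by rewrite mulr_ge0 ?Y0// ltW. Qed.

(** [min(S Y, M)] has mean [E[S u(M / S)]]; in [S (e M / S + c)] the linear term is unchanged, while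
    [c] acquires the factor [rho < 1]. *)
Let step e c : (forall M, 0 <= M -> u M <= e * M + c) ->
  forall M, 0 <= M -> u M <= e * M + (rho * c + beta).
Proof.
move=> uc M M0.
have LminSY : L1 P (fun w => Num.min (S w * Y w) M) by exact: L1_min.
have u1 : u M <= \int[P]_w Num.min (S w * Y w) M + beta.
  have -> : u M = \int[P]_w Num.min (Y' w) M.
    exact: tmean_eq_law.
  rewrite -ExD//; apply: Ex_ae_le.
  - exact: L1_min.
  - exact: L1D.
  - apply: filterS Y'_le => w hw; have := b0 w.
    by rewrite /Num.min; case: ltP => h1; case: ltP => h2; lra.
apply: (le_trans u1); rewrite addrA lerD2r.
rewrite -lee_fin L1_fineK//.
have mf : measurable_fun [set: R * R] (fun z => (Num.max 0 (Num.min (z.1 * z.2) M))%:E).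
  apply/measurable_EFinP; apply: measurable_maxr; first exact: measurable_cst.
  apply: measurable_minr; last exact: measurable_cst.
  by apply: measurable_funM; [exact: measurable_fst|exact: measurable_snd].
have E z y : 0 <= z * y -> Num.max 0 (Num.min (z * y) M) = Num.min (z * y) M.
  by move=> zy; rewrite max_r// le_min zy.
have := indep_tonelli P S Y mS mY indepSY _ mf.
rewrite (eq_integral (fun w => (Num.min (S w * Y w) M)%:E)); last first.
  by move=> w _; rewrite /= E.
move=> -> /=; last by move=> z; rewrite lee_fin le_max lexx.
have LR : L1 P (fun w => e * M + c * S w) by apply: L1D; [exact: L1_cst|exact: L1Z].
have -> : e * M + rho * c = \int[P]_w (e * M + c * S w).
  by rewrite (mulrC rho) ExD ?Ex_cst ?ExZ//; [exact: L1_cst|exact: L1Z].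
rewrite L1_fineK//.
have inner w : (\int[P]_w' (Num.max 0 (Num.min (S w * Y w') M))%:E <=
    (e * M + c * S w)%:E)%E.
  have S0w := S0 w.
  have -> : (\int[P]_w' (Num.max 0 (Num.min (S w * Y w') M))%:E =
      (S w * u (M / S w))%:E)%E.
    rewrite EFinM /u /tmean L1_fineK; last by apply: L1_min => //; rewrite divr_ge0// ltW.
    rewrite -ge0_integralZl//.
    - apply: eq_integral => w' _; rewrite E ?mulr_ge0 ?(ltW S0w)// -EFinM.
      by rewrite minr_pMr ?(ltW S0w)// mulrC [S w * (M / _)]mulrC divfK// gt_eqF.
    - apply/measurable_EFinP; apply: measurable_minr => //; exact: measurable_cst.
    - by move=> w' _; rewrite lee_fin le_min Y0 divr_ge0// ltW.
    - by rewrite lee_fin ltW.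
  have MS0 : 0 <= M / S w by rewrite divr_ge0// ltW.
  rewrite lee_fin; have := uc _ MS0; rewrite -(ler_pM2l S0w).
  rewrite (_ : S w * (e * (M / S w) + c) = e * M + c * S w)//.
  by field; rewrite gt_eqF.
have mF : measurable_fun [set: Om] (fun w =>
    \int[P]_w' (Num.max 0 (Num.min (S w * Y w') M))%:E)%E.
  pose f' (z : R * Om) := (Num.max 0 (Num.min (z.1 * Y z.2) M))%:E.
  have mf' : measurable_fun [set: R * Om] f'.
    have mp : measurable_fun [set: R * Om] (fun z => (z.1, Y z.2)).
      apply: measurable_fun_pair; first exact: measurable_fst.
      by apply: measurableT_comp => //; exact: measurable_snd.
    exact: (measurableT_comp mf mp).
  have f'0 z : (0 <= f' z)%E by rewrite lee_fin le_max lexx.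
  have mFF := measurable_fun_fubini_tonelli_F (m2 := P) f' mf' f'0.
  exact: (measurableT_comp mFF mS).
apply: ge0_le_integral => //.
- by move=> w _; apply: integral_ge0 => w' _; rewrite lee_fin le_max lexx.
- by apply/measurable_EFinP; exact: L1_measurable LR.
Qed.

(** Taking means in [Y' <= S Y + b] says nothing while [E Y] may be infinite. Truncated means are
    finite: [step] drives the constant in [u M <= e * M + c] to the fixed point [K], then [e] tends
    to 0 and [M] to infinity. *)
Lemma contractive_moment : L1 P Y.
Proof.
have rho0 : 0 <= rho by apply: Ex_ge0 => w; exact: ltW.
have beta0 : 0 <= beta by exact: Ex_ge0.
have r1 : 0 < 1 - rho by rewrite subr_gt0.
pose K := beta / (1 - rho).
have KE : rho * K + beta = K by rewrite /K; field; rewrite gt_eqF.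
have uM e M : 0 < e -> 0 <= M -> u M <= e * M + K.
  move=> e0 M0.
  (* [u] is sublinear: its slope is at most [tail], which is below [e] past some [n]. *)
  have [c c0 h0] : exists2 c, 0 <= c & forall M, 0 <= M -> u M <= e * M + c.
    have natoo : (fun n : nat => n%:R : R) @ \oo --> +oo.
      apply/cvgryPge => A; exists (Num.trunc `|A|).+1 => // n /= hn.
      apply: (le_trans (ler_norm A)); apply: ltW.
      by apply: (lt_le_trans (truncnS_gt _)); rewrite ler_nat.
    have /cvgrPdist_lt/(_ e e0)[n _ /(_ n (leqnn n))] := tail_cvg0 P Y mY _ natoo.
    rewrite sub0r normrN ger0_norm ?tail_ge0// => tn.
    exists n%:R => // N N0; case: (leP N n%:R) => Nn.
      apply: (@le_trans _ _ N).
        rewrite -[leRHS](Ex_cst P); apply: le_Ex => [||w]; [exact: L1_min|exact: L1_cst|].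
        by rewrite ge_min lexx orbT.
      by rewrite (le_trans Nn)// lerDr mulr_ge0// ltW.
    have /andP[_ h] := tmean_incr P Y mY Y0 n%:R N (ler0n _ _) (ltW Nn).
    have h2 : u n%:R <= n%:R.
      rewrite -[leRHS](Ex_cst P); apply: le_Ex => [||w]; [exact: L1_min|exact: L1_cst|].
      by rewrite ge_min lexx orbT.
    have h3 : tail P Y n%:R * (N - n%:R) <= e * N.
      apply: ler_pM; [exact: tail_ge0|lra|exact: ltW|].
      by rewrite gerBl.
    by rewrite -/u in h; lra.
  have it n : forall M, 0 <= M -> u M <= e * M + (rho ^+ n * c + K).
    elim: n => [|n IH] N N0.
      apply: (le_trans (h0 _ N0)); rewrite expr0 mul1r lerD2l lerDl.
      by rewrite divr_ge0// ltW.
    apply: (le_trans (step _ _ IH N N0)).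
    by rewrite exprS mulrDr -addrA KE mulrA.
  have lim : e * M + (rho ^+ n * c + K) @[n --> \oo] --> e * M + (0 * c + K).
    apply: cvgD; first exact: cvg_cst.
    apply: cvgD; last exact: cvg_cst.
    apply: cvgMl; apply: cvg_expr; rewrite ger0_norm//.
  rewrite mul0r add0r in lim; apply: (cvgr_to_ge lim).
  by apply: nearW => n; exact: it.
have uK M : 0 <= M -> u M <= K.
  move=> M0; apply/ler_addgt0Pl => e e0.
  have M10 : 0 < M + 1 by lra.
  have e'0 : 0 < e / (M + 1) by rewrite divr_gt0.
  apply: (le_trans (uM _ _ e'0 M0)); rewrite lerD2r.
  by rewrite mulrAC ler_pdivrMr// ler_pM2l// lerDl.
apply: L1_ge0 => //; apply: (@le_lt_trans _ _ K%:E); last exact: ltry.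
have lim : (\int[P]_w (Num.min (Y w) n%:R)%:E)%E @[n --> \oo] --> (\int[P]_w (Y w)%:E)%E.
  rewrite [X in _ --> X](eq_integral
    (fun w => limn (fun n : nat => (Num.min (Y w) n%:R)%:E))); last first.
    move=> w _; apply/esym/cvg_lim => //.
    apply: cvg_near_cst; exists (Num.trunc (Y w)).+1 => // n /= hn.
    rewrite min_l//; apply/ltW/(lt_le_trans (truncnS_gt _)).
    by rewrite ler_nat.
  apply: cvg_monotone_convergence => //.
  - by move=> n; apply/measurable_EFinP; apply: measurable_minr => //; exact: measurable_cst.
  - by move=> n w _; rewrite lee_fin le_min Y0 ler0n.
  - move=> w _ n m' nm; rewrite lee_fin le_min ge_min lexx/= ge_min.
    by rewrite ler_nat nm orbT.
rewrite -(cvg_lim _ lim)//; apply: lime_le; first by apply/cvg_ex; eexists; exact: lim.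
apply: nearW => n; rewrite -L1_fineK; last exact: L1_min.
by rewrite lee_fin; exact: uK.
Qed.

End ContractiveMoment.

(** * Asymptotically linear recursions *)

Lemma lnpE {R : realType} : @lnp R = fun x => Num.max 0 (ln x).
Proof.
apply/funext => x; rewrite /lnp; case: ltP => x1.
  by rewrite max_r// ln_ge0// ltW.
by rewrite max_l// ln_le0.
Qed.

Lemma indep_comp {dO d1 d2 d3 d4} {R : realType} {Om : measurableType dO}
    (P : probability Om R) {T1 : measurableType d1} {T2 : measurableType d2}
    {T3 : measurableType d3} {T4 : measurableType d4}
    (Y1 : Om -> T1) (Y2 : Om -> T2) (f : T1 -> T3) (g : T2 -> T4) :
  measurable_fun [set: T1] f -> measurable_fun [set: T2] g ->
  indep P Y1 Y2 -> indep P (f \o Y1) (g \o Y2).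
Proof.
move=> mf mg Y12 E F mE mF; apply: (Y12 (f @^-1` E) (g @^-1` F)).
- by rewrite -[f @^-1` E]setTI; exact: mf.
- by rewrite -[g @^-1` F]setTI; exact: mg.
Qed.

Lemma eq_law_comp {dO d1 d2} {R : realType} {Om : measurableType dO}
    (P : probability Om R) {T1 : measurableType d1} {T2 : measurableType d2}
    (Y Y' : Om -> T1) (f : T1 -> T2) : measurable_fun [set: T1] f ->
  (forall S, measurable S -> P (Y @^-1` S) = P (Y' @^-1` S)) ->
  forall S, measurable S -> P ((fun w => f (Y w)) @^-1` S) = P ((fun w => f (Y' w)) @^-1` S).
Proof.
move=> mf YY' S mS; apply: (YY' (f @^-1` S)).
by rewrite -[f @^-1` S]setTI; exact: mf.
Qed.

(** In [defect_gt0], [a] is [(1 + del) * rho], [p] is the probability that [H c] is positive at [X],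
    and [E] is the mean of [pos X ^ be] on that event. Half of the drift [c (1 - a) E] pays for [k];
    the other half pays for the constants since [E >= L p]. *)
Lemma mean_defect_gt0 {R : realFieldType} (c a k v1 v2 L p E : R) :
  1 <= c -> 0 <= v1 -> 0 < 1 - a -> k <= c * (1 - a) / 2 -> 0 <= L ->
  L * (1 - a) = 2 * (v1 + v2 + 1) -> 0 < p -> L * p <= E ->
  0 < c * E - (c * a + k) * E - (v1 + c * v2) * p.
Proof.
move=> c1 v10 a1 kc L0 LE p0 LpE.
have c0 : 0 < c by lra.
have k1 : c * (1 - a) / 2 <= c - (c * a + k) by lra.
have k2 : c * (1 - a) / 2 * (L * p) <= (c - (c * a + k)) * E.
  by apply: ler_pM => //; [rewrite divr_ge0// mulr_ge0// ltW|rewrite mulr_ge0// ltW].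
have k3 : c * (1 - a) / 2 * (L * p) = c * (v1 + v2 + 1) * p.
  rewrite (_ : _ * _ = c * (L * (1 - a)) * p / 2); last by ring.
  by rewrite LE; field.
have k4 : (v1 + c * v2) * p < c * (v1 + v2 + 1) * p.
  rewrite ltr_pM2r//.
  have : v1 <= c * v1 by rewrite ler_peMl.
  by lra.
by lra.
Qed.

Lemma pointwise_defect_ge {R : realFieldType} (c e C K T h' p' p q' g W ba bb a : R) :
  0 <= c -> q' <= e * (a * g) + C * bb -> p' - c * q' <= h' ->
  - (K * (ba + W * g)) <= p' - T * p ->
  c * (T * g) - (c * e * a + K * W) * g - (K * ba + c * C * bb) <=
    h' - T * (p - c * g).
Proof. by move=> c0 /(ler_wpM2l c0) h1 h2 h3; lra. Qed.

Section AsymptoticallyLinear.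
Context {dO dT : measure_display} {Om : measurableType dO} {R : realType}.
Context {Th : measurableType dT}.
Variables (P : probability Om R) (om : Om -> Th) (X X' : Om -> R) (A B : Th -> R).
Hypotheses (mom : measurable_fun [set: Om] om) (mX : measurable_fun [set: Om] X)
  (mX' : measurable_fun [set: Om] X').
Hypothesis indepX : indep P om X.
Hypothesis lawX : forall S : set R, measurable S -> P (X @^-1` S) = P (X' @^-1` S).
Hypotheses (mA : measurable_fun [set: Th] A) (mB : measurable_fun [set: Th] B).
Hypothesis A0 : forall th, 0 < A th.
Hypothesis X'_near : {ae P, forall w, `|X' w - A (om w) * X w| <= `|B (om w)|}.
Variable alpha : R.
Hypothesis alpha0 : 0 < alpha.
Hypothesis EAalpha : (\int[P]_w (A (om w) `^ alpha)%:E = 1)%E.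
Hypothesis moments : (\int[P]_w ((`|B (om w)| `^ alpha +
  A (om w) `^ alpha * lnp (A (om w)))%:E) < +oo)%E.
Hypothesis nonarith : ~ arithmetic_law P (fun w => ln (A (om w))).

Let xi w := alpha * ln (A (om w)).

Let expR_xi w : expR (xi w) = A (om w) `^ alpha.
Proof. by rewrite /powR gt_eqF. Qed.

Let mAom : measurable_fun [set: Om] (A \o om). Proof. exact: measurableT_comp. Qed.
Let mBom : measurable_fun [set: Om] (B \o om). Proof. exact: measurableT_comp. Qed.

Let mpow (f : Om -> R) r : measurable_fun [set: Om] f ->
  measurable_fun [set: Om] (fun w => f w `^ r).
Proof. by move=> mf; exact: (measurableT_comp (measurable_powR r)). Qed.

Let mlnA : measurable_fun [set: Om] (fun w => ln (A (om w))).
Proof. exact: (measurableT_comp (@measurable_ln R)). Qed.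

Let mxi : measurable_fun [set: Om] xi.
Proof. by apply: measurable_funM => //; exact: measurable_cst. Qed.

Let xi_nonarith : ~ arithmetic_law P xi.
Proof.
move=> [c [c0 h]]; apply: nonarith; exists (c / alpha); split; first exact: divr_gt0.
rewrite -h; congr (P _); apply/seteqP; split => w [k hk]; exists k.
  by rewrite /xi hk; field; rewrite gt_eqF.
by rewrite mulrA -hk /xi; field; rewrite gt_eqF.
Qed.

Let mnormB : measurable_fun [set: Om] (fun w => `|B (om w)|).
Proof. exact: (measurableT_comp (@normr_measurable R setT)). Qed.

Let LT : L1 P (fun w => A (om w) `^ alpha).
Proof.
apply: L1_ge0; [exact: mpow|by move=> w; exact: powR_ge0|].
by rewrite EAalpha ltry.
Qed.

Let LTxi : L1 P (fun w => expR (xi w)).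
Proof. by rewrite (funext expR_xi). Qed.

Let ETxi : \int[P]_w expR (xi w) = 1.
Proof. by rewrite (funext expR_xi) /Rintegral EAalpha. Qed.

Let mlnpA : measurable_fun [set: Om] (fun w => lnp (A (om w))).
Proof. by rewrite lnpE; apply: measurable_maxr => //; exact: measurable_cst. Qed.

Let Lmoments : L1 P (fun w => `|B (om w)| `^ alpha + A (om w) `^ alpha * lnp (A (om w))).
Proof.
apply: L1_ge0 => //.
- apply: measurable_funD; first exact: mpow.
  by apply: measurable_funM => //; exact: mpow.
- by move=> w; rewrite addr_ge0 ?mulr_ge0 ?powR_ge0// lnpE le_max lexx.
Qed.

Let LBalpha : L1 P (fun w => `|B (om w)| `^ alpha).
Proof.
apply: (L1_le P _ _ _ Lmoments); first exact: mpow.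
move=> w; rewrite ger0_norm ?powR_ge0// lerDl mulr_ge0 ?powR_ge0//.
by rewrite lnpE le_max lexx.
Qed.

(** The moment hypothesis controls the part [xi >= 0]; where [xi < 0], [|xi| exp xi] is at most
    1. *)
Let LTxi_xi : L1 P (fun w => expR (xi w) * xi w).
Proof.
have LL : L1 P (fun w => alpha * (`|B (om w)| `^ alpha +
    A (om w) `^ alpha * lnp (A (om w))) + 1) by apply: L1D; [exact: L1Z|exact: L1_cst].
apply: (L1_le P _ _ _ LL); first by apply: measurable_funM => //; exact: L1_measurable LTxi.
move=> w; have B0 := powR_ge0 `|B (om w)| alpha.
have aB0 : 0 <= alpha * `|B (om w)| `^ alpha by rewrite mulr_ge0// ltW.
rewrite normrM ger0_norm ?expR_ge0// mulrDr lnpE; have [l0|l0] := leP 0 (ln (A (om w))).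
  rewrite expR_xi /xi normrM gtr0_norm// ger0_norm// mulrCA.
  by rewrite -addrA addrC -addrA lerDl addr_ge0.
rewrite !mulr0 addr0.
apply: (@le_trans _ _ 1); last by rewrite lerDr.
have x0 : xi w < 0 by rewrite pmulr_rlt0.
rewrite ltr0_norm//; have := ler_wpM2l (expR_ge0 (xi w)) (expR_ge1Dx (- xi w)).
by rewrite -expRD subrr expR0; have := expR_gt0 (xi w); lra.
Qed.

(** An exponent strictly between [max(0, alpha - 1)] and [alpha]: the lower bounds serve
    [powR_dist_le], the upper one gives [E A^be < 1]. *)
Let be := Num.max (alpha / 2) (alpha - 1 / 2).

Let be_gt : alpha - 1 < be. Proof. by rewrite lt_max; apply/orP; right; lra. Qed.
Let be_lt : be < alpha. Proof. by rewrite gt_max; have := alpha0 => ?; apply/andP; split; lra. Qed.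
Let be0 : 0 < be. Proof. by rewrite lt_max divr_gt0. Qed.

Let LBbe : L1 P (fun w => `|B (om w)| `^ be).
Proof.
have LL : L1 P (fun w => 1 + `|B (om w)| `^ alpha) by apply: L1D => //; exact: L1_cst.
apply: (L1_le P _ _ _ LL); first exact: mpow.
by move=> w; rewrite ger0_norm ?powR_ge0//; exact: powR_le_1D.
Qed.

Let Abe_lt1 : L1 P (fun w => A (om w) `^ be) /\ \int[P]_w (A (om w) `^ be) < 1.
Proof.
have E w : A (om w) `^ be = expR (be / alpha * xi w).
  by rewrite /powR gt_eqF// /xi; congr expR; field; rewrite gt_eqF.
rewrite (funext E); apply: tilt_moment_lt1 => //; first exact: divr_gt0.
by rewrite ltr_pdivrMr// mul1r.
Qed.

Let slack : exists2 del, 0 < del & (1 + del) * \int[P]_w (A (om w) `^ be) < 1.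
Proof.
have [_ r1] := Abe_lt1; set r := Rintegral _ _ _ in r1 *.
have r0 : 0 <= r by apply: Ex_ge0 => w; exact: powR_ge0.
exists ((1 - r) / 2); first by rewrite divr_gt0// subr_gt0.
have : 0 < (1 - r) * (1 - r / 2) by rewrite mulr_gt0; lra.
by lra.
Qed.

Let X'_norm_le : {ae P, forall w, `|X' w| <= A (om w) * `|X w| + `|B (om w)|}.
Proof.
apply: filterS X'_near => w h.
have := ler_normD (X' w - A (om w) * X w) (A (om w) * X w).
by rewrite subrK normrM (gtr0_norm (A0 _)); lra.
Qed.

Let mpowA r : measurable_fun [set: Th] (fun th => A th `^ r).
Proof. exact: (measurableT_comp (measurable_powR r)). Qed.

Let mpowX r : measurable_fun [set: R] (fun x : R => `|x| `^ r).
Proof. exact: (measurableT_comp (measurable_powR r)). Qed.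

(** [powR_add_le] makes [|X|^be] a recursion whose factor [(1 + del) A^be] has mean below 1 by
    [slack]. *)
Let LXbe : L1 P (fun w => `|X w| `^ be).
Proof.
have [del del0 hdel] := slack; have [LA _] := Abe_lt1.
have [C C0 hC] := powR_add_le be del be0 del0.
apply: (contractive_moment P _ (fun w => `|X' w| `^ be)
  (fun w => (1 + del) * A (om w) `^ be) (fun w => C * `|B (om w)| `^ be)).
- exact: (measurableT_comp (mpowX be)).
- exact: (measurableT_comp (mpowX be)).
- by move=> w; exact: powR_ge0.
- by move=> w; exact: powR_ge0.
- by move=> w; rewrite mulr_gt0 ?powR_gt0//; lra.
- by move=> w; rewrite mulr_ge0 ?powR_ge0.
- apply: (indep_comp P om X (fun th => (1 + del) * A th `^ be) (fun x => `|x| `^ be)) => //.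
  by apply: measurable_funM => //; exact: measurable_cst.
- exact: (eq_law_comp P X X' _ (mpowX be) lawX).
- exact: L1Z.
- by rewrite ExZ.
- exact: L1Z.
- apply: filterS X'_norm_le => w h.
  apply: (@le_trans _ _ ((A (om w) * `|X w| + `|B (om w)|) `^ be)).
    apply: ge0_ler_powR; rewrite ?nnegrE ?(ltW be0)//.
    by rewrite addr_ge0// mulr_ge0// ltW.
  apply: (le_trans (hC _ _ _ _)) => //; first by rewrite mulr_ge0// ltW.
  by rewrite powRM ?(ltW (A0 _))// mulrA.
Qed.

(** * Test functions and their defects *)

Let pos (x : R) := Num.max 0 x.
(** At [c = 0] this is [pos x ^ alpha], so one family serves both existence and positivity. *)
Let H (c x : R) := pos (pos x `^ alpha - c * pos x `^ be).

Let pos_ge0 x : 0 <= pos x. Proof. by rewrite le_max lexx. Qed.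

Let pos_le_norm x : pos x <= `|x|.
Proof. by rewrite ge_max normr_ge0 ler_norm. Qed.

Let mpos : measurable_fun [set: R] pos.
Proof. by apply: measurable_maxr => //; exact: measurable_cst. Qed.

Let mpospow r : measurable_fun [set: R] (fun x => pos x `^ r).
Proof. exact: (measurableT_comp (measurable_powR r)). Qed.

Let mH c : measurable_fun [set: R] (H c).
Proof.
apply: (measurableT_comp mpos); apply: measurable_funB => //.
by apply: measurable_funM => //; exact: measurable_cst.
Qed.

Let H_bounds c x : 0 <= c -> pos x `^ alpha - c * pos x `^ be <= H c x <= pos x `^ alpha.
Proof.
move=> c0; have h : 0 <= c * pos x `^ be by rewrite mulr_ge0 ?powR_ge0.
by rewrite /H {2 4}/pos le_max lexx orbT ge_max powR_ge0 gerBl.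
Qed.

Let pos_near : {ae P, forall w, `|pos (X' w) - A (om w) * pos (X w)| <= `|B (om w)|}.
Proof.
apply: filterS X'_near => w; apply: le_trans.
have -> : A (om w) * pos (X w) = pos (A (om w) * X w).
  by rewrite /pos maxr_pMr ?mulr0// ltW.
rewrite /pos /Num.max; move: (X' w) (_ * X w) => x y.
have := ler_norm (x - y); have := ler_norm (y - x); rewrite distrC => h1 h2.
by case: ltP => h3; case: ltP => h4; rewrite ?subrr ?normr0// ler_norml;
  apply/andP; split; lra.
Qed.

(** Coefficient of [pos X ^ be] in the error of [powR_dist_le] at [a = A pos X] and [b = |B|]; it
    depends on [om] alone, hence is independent of [X]. *)
Let Wf (th : Th) := `|B th| `^ (alpha - be) * A th `^ be.

Let mnormBth : measurable_fun [set: Th] (fun th => `|B th|).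
Proof. exact: (measurableT_comp (@normr_measurable R setT)). Qed.

Let mWf : measurable_fun [set: Th] Wf.
Proof.
by apply: measurable_funM => //; exact: (measurableT_comp (measurable_powR _)).
Qed.

Let Wf0 th : 0 <= Wf th. Proof. by rewrite mulr_ge0 ?powR_ge0. Qed.

Let LWf : L1 P (Wf \o om).
Proof.
apply: (L1_le P _ _ _ (L1D _ _ _ LBalpha LT)); first exact: measurableT_comp.
by move=> w; rewrite /= ger0_norm//; apply: powR_young => //; exact: ltW.
Qed.

Let g w := pos (X w) `^ be.

Let Lg : L1 P g.
Proof.
apply: (L1_le P _ _ _ LXbe); first exact: (measurableT_comp (mpospow be)).
move=> w; rewrite ger0_norm ?powR_ge0//.
by apply: ge0_ler_powR; rewrite ?nnegrE ?(ltW be0).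
Qed.

Let Lg' : L1 P (fun w => pos (X' w) `^ be).
Proof.
apply: L1_ge0.
- exact: (measurableT_comp (mpospow be)).
- by move=> w; exact: powR_ge0.
- rewrite -(eq_law_integral P X X' (fun x => (pos x `^ be)%:E))//.
  + exact: L1_lty Lg.
  + exact/measurable_EFinP.
  + by move=> x; rewrite lee_fin powR_ge0.
Qed.

Let LTg : L1 P (fun w => expR (xi w) * g w).
Proof.
rewrite (_ : (fun w => _) = fun w => A (om w) `^ alpha * g w); last first.
  by apply/funext => w; rewrite expR_xi.
by have [] := indep_integralM P om X mom mX indepX _ _ (mpowA alpha) (mpospow be)
  (fun=> powR_ge0 _ _) (fun=> powR_ge0 _ _) LT Lg.
Qed.

Let LWg : L1 P (fun w => Wf (om w) * g w).
Proof.
by have [] := indep_integralM P om X mom mX indepX _ _ mWf (mpospow be)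
  Wf0 (fun=> powR_ge0 _ _) LWf Lg.
Qed.

Let pow_near : exists2 K, 0 <= K & {ae P, forall w,
  `|pos (X' w) `^ alpha - expR (xi w) * pos (X w) `^ alpha| <=
    K * (`|B (om w)| `^ alpha + Wf (om w) * g w)}.
Proof.
have [K K0 hK] := powR_dist_le alpha be be_gt be0 be_lt.
exists K => //; apply: filterS pos_near => w h.
have A0' := ltW (A0 (om w)).
have := hK (A (om w) * pos (X w)) `|B (om w)| (pos (X' w)).
rewrite mulr_ge0// => /(_ isT (normr_ge0 _) (pos_ge0 _) h).
by rewrite !powRM// expR_xi mulrA.
Qed.

Let mZ c (Y : Om -> R) : measurable_fun [set: Om] Y ->
  measurable_fun [set: Om] (fun w => H c (Y w)).
Proof. by move=> mY; exact: (measurableT_comp (mH c)). Qed.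

Let defect c := \int[P]_w (H c (X' w) - expR (xi w) * H c (X w)).

(** The two terms need not be integrable separately. In the difference the powers of order [alpha]
    cancel up to [pow_near], and the rest is of order [be]. *)
Let Ldefect c : 0 <= c -> L1 P (fun w => H c (X' w) - expR (xi w) * H c (X w)).
Proof.
move=> c0; have [K K0 hK] := pow_near.
have LL : L1 P (fun w => K * (`|B (om w)| `^ alpha + Wf (om w) * g w) +
    (c * pos (X' w) `^ be + c * (expR (xi w) * g w))).
  by apply: L1D; [apply: L1Z; exact: L1D|apply: L1D; exact: L1Z].
apply: (L1_ae_le P _ _ _ LL).
  apply: measurable_funB; first exact: mZ.
  by apply: measurable_funM; [exact: L1_measurable LTxi|exact: mZ].
apply: filterS hK => w.
have /andP[l' u'] := H_bounds c (X' w) c0; have /andP[l u] := H_bounds c (X w) c0.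
have e0 := expR_gt0 (xi w).
move: l u; rewrite -(ler_pM2l e0) -[H c (X w) <= _](ler_pM2l e0) mulrBr mulrCA.
have q' : 0 <= c * pos (X' w) `^ be by rewrite mulr_ge0 ?powR_ge0.
have q : 0 <= c * (expR (xi w) * g w).
  by apply: mulr_ge0 => //; apply: mulr_ge0; [exact: ltW|exact: powR_ge0].
rewrite -/(g w) => l u /ler_normlP[a1 a2]; apply/ler_normlP.
move: l' u' l u q' q a1 a2; move: (H c (X' w)) (expR (xi w) * H c (X w))
  (pos (X' w) `^ alpha) (expR (xi w) * pos (X w) `^ alpha) (c * pos (X' w) `^ be)
  (c * (expR (xi w) * g w)) (K * _).
by move=> x1 x2 x3 x4 x5 x6 x7 *; split; lra.
Qed.

Let renewal c : 0 <= c ->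
  M * tail P (fun w => H c (X w)) M @[M --> +oo] -->
    defect c / \int[P]_w (expR (xi w) * xi w).
Proof.
move=> c0.
have mlnth : measurable_fun [set: Th] (fun th => alpha * ln (A th)).
  apply: measurable_funM; first exact: measurable_cst.
  exact: (measurableT_comp (@measurable_ln R)).
exact: (implicit_renewal P xi _ _ mxi LTxi ETxi xi_nonarith LTxi_xi (mZ c X mX)
  (mZ c X' mX') (fun=> pos_ge0 _) (fun=> pos_ge0 _)
  (indep_comp P om X _ _ mlnth (mH c) indepX)
  (eq_law_comp P X X' _ (mH c) lawX) (Ldefect c c0)).
Qed.

Let m_gt0 : 0 < \int[P]_w (expR (xi w) * xi w).
Proof. exact: tilt_mean_gt0. Qed.

(** Off the set [J] where [H c] is positive, [H c (X w) = 0] and the integrand is nonnegative; on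
    [J] it is bounded below by the drift minus errors. The resulting minorant [Q] has an explicit
    mean, by independence. *)
Let defect_gt0 : (forall M : R, exists2 x, law_support P X x & M < x) ->
  exists2 c, 0 <= c & 0 < defect c.
Proof.
move=> unb; have [del del0] := slack; have [LA rho1] := Abe_lt1.
have [C C0 hC] := powR_add_le be del be0 del0.
have [K K0 hK] := pow_near.
set rho := Rintegral _ _ _ => rho'1.
have rho0 : 0 <= rho by apply: Ex_ge0 => w; exact: powR_ge0.
pose r := 1 - (1 + del) * rho; have r0 : 0 < r by rewrite subr_gt0.
pose kap := \int[P]_w Wf (om w).
have kap0 : 0 <= kap by apply: Ex_ge0 => w; exact: Wf0.
pose ba := \int[P]_w (`|B (om w)| `^ alpha).
have ba0 : 0 <= ba by apply: Ex_ge0 => w; exact: powR_ge0.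
pose bb := \int[P]_w (`|B (om w)| `^ be).
have bb0 : 0 <= bb by apply: Ex_ge0 => w; exact: powR_ge0.
pose L := 2 * (K * ba + C * bb + 1) / r.
have Kba0 : 0 <= K * ba by exact: mulr_ge0.
have Cbb0 : 0 <= C * bb by exact: mulr_ge0.
have L0 : 0 < L by rewrite divr_gt0//; lra.
have ab0 : 0 < alpha - be by rewrite subr_gt0.
(* The summands give in turn [c1], [cK] (the error of order [be] uses at most half of the drift) and
   [cL] ([pos x ^ be >= L] on [J]). *)
pose c := 1 + 2 * K * kap / r + L `^ ((alpha - be) / be).
have Kk0 : 0 <= 2 * K * kap / r by rewrite divr_ge0 ?(ltW r0)// !mulr_ge0.
have Lp0 := powR_ge0 L ((alpha - be) / be).
have c1 : 1 <= c by rewrite /c; lra.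
have c0 : 0 < c by lra.
have cK : K * kap <= c * r / 2.
  have : 2 * K * kap / r <= c by rewrite /c; lra.
  by rewrite ler_pdivrMr//; lra.
have cL x : 0 <= x -> c * x `^ be < x `^ alpha -> L <= x `^ be.
  move=> x0 hx; have xp : 0 < x.
    rewrite lt0r x0 andbT; apply: contraTneq hx => ->.
    by rewrite !powR0 ?mulr0 ?ltxx// gt_eqF.
  have : c < x `^ (alpha - be).
    rewrite -(ltr_pM2r (powR_gt0 be xp)) -powRD ?subrK//.
    by rewrite (gt_eqF xp) implybT.
  move=> cx; have : L `^ ((alpha - be) / be) <= x `^ (alpha - be) by rewrite /c in cx; lra.
  move=> /(ge0_ler_powR (r := be / (alpha - be)) (divr_ge0 (ltW be0) (ltW ab0))).
  rewrite !nnegrE !powR_ge0 -!powRrM => /(_ isT isT).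
  rewrite (_ : (alpha - be) / be * _ = 1); last by field; rewrite !gt_eqF.
  by rewrite (_ : (alpha - be) * _ = be) ?powRr1 ?(ltW L0)//; field; rewrite gt_eqF.
pose J := [set x : R | c * pos x `^ be < pos x `^ alpha].
have mJ : measurable J.
  have -> : J = (fun x => pos x `^ alpha - c * pos x `^ be) @^-1` `]0, +oo[.
    by apply/seteqP; split => x /=; rewrite in_itv/= andbT subr_gt0.
  rewrite -[X in measurable X]setTI.
  have : measurable_fun [set: R] (fun x => pos x `^ alpha - c * pos x `^ be).
    apply: measurable_funB => //; apply: measurable_funM => //; exact: measurable_cst.
  by apply => //.
have mXJ : measurable (X @^-1` J) by rewrite -[X in measurable X]setTI; exact: mX.
pose gJ (x : R) := \1_J x * pos x `^ be.
have mgJ : measurable_fun [set: R] gJ by exact: measurable_funM.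
have gJ0 x : 0 <= gJ x by rewrite mulr_ge0 ?powR_ge0.
have LgJ : L1 P (gJ \o X).
  apply: (L1_le P _ _ _ Lg); first exact: measurableT_comp.
  move=> w; rewrite /comp ger0_norm// /gJ indicE.
  by case: (_ \in _); rewrite ?mul1r// mul0r powR_ge0.
have LJ : L1 P (\1_J \o X).
  rewrite (_ : _ \o _ = \1_(X @^-1` J)); first exact: L1_indic.
  by apply/funext => w; rewrite /= !indicE; congr (_%:R); apply/idP/idP; rewrite !inE.
have indic0 x : 0 <= \1_J x :> R by [].
pose V th := K * `|B th| `^ alpha + c * C * `|B th| `^ be.
pose U th := c * (1 + del) * A th `^ be + K * Wf th.
have V0 th : 0 <= V th by rewrite addr_ge0 ?mulr_ge0 ?powR_ge0 ?(ltW c0).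
have U0 th : 0 <= U th.
  by rewrite addr_ge0 ?mulr_ge0 ?powR_ge0 ?(ltW c0) ?Wf0//; lra.
have mBp q : measurable_fun [set: Th] (fun th => `|B th| `^ q).
  exact: (measurableT_comp (measurable_powR q)).
have mV : measurable_fun [set: Th] V.
  by apply: measurable_funD; apply: measurable_funM => //; exact: measurable_cst.
have mU : measurable_fun [set: Th] U.
  by apply: measurable_funD; apply: measurable_funM => //; exact: measurable_cst.
have LV : L1 P (V \o om) by apply: L1D; exact: L1Z.
have LU : L1 P (U \o om) by apply: L1D; exact: L1Z.
have EV : \int[P]_w V (om w) = K * ba + c * C * bb by rewrite ExD ?ExZ//; exact: L1Z.
have EU : \int[P]_w U (om w) = c * (1 + del) * rho + K * kap.
  by rewrite ExD ?ExZ//; exact: L1Z.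
have [LTgJ ETgJ] := indep_integralM P om X mom mX indepX _ _ (mpowA alpha) mgJ
  (fun=> powR_ge0 _ _) gJ0 LT LgJ.
have [LUg EUg] := indep_integralM P om X mom mX indepX _ _ mU mgJ U0 gJ0 LU LgJ.
have [LVJ EVJ] := indep_integralM P om X mom mX indepX _ _ mV
  (measurable_indic mJ) V0 indic0 LV LJ.
pose Q w := c * (A (om w) `^ alpha * gJ (X w)) - U (om w) * gJ (X w) -
  V (om w) * \1_J (X w).
have LQ : L1 P Q by apply: L1B => //; apply: L1B => //; exact: L1Z.
exists c; first exact: ltW.
(* [J] contains everything above [x0], and an unbounded support charges a unit ball centred beyond
   [x0 + 1]. *)
have PJ0 : 0 < \int[P]_w \1_J (X w).
  rewrite (_ : (fun w => _) = \1_(X @^-1` J)); last first.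
    by apply/funext => w; rewrite /= !indicE; congr (_%:R); apply/idP/idP; rewrite !inE.
  rewrite Ex_indic//; pose x0 := c `^ (alpha - be)^-1.
  have [x suppx xx0] := unb (x0 + 1).
  have suppx1 := suppx _ ltr01.
  apply: fine_gt0; rewrite -ge0_fin_numE// fin_num_measure// andbT.
  apply: (lt_le_trans suppx1); apply: le_measure; rewrite ?inE//.
    by rewrite -[X in measurable X]setTI; apply: mX => //; exact: measurable_ball.
  move=> w /=; rewrite /ball/= ltr_norml => /andP[_ hw].
  have xX : x0 < X w.
    by rewrite -(ltrD2r 1); apply: (lt_trans xx0); rewrite -ltrBlDl.
  have x00 : 0 <= x0 by exact: powR_ge0.
  have X0 : 0 < X w by exact: le_lt_trans xX.
  rewrite /J/= /pos max_r ?(ltW X0)//.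
  have : c < X w `^ (alpha - be).
    have -> : c = x0 `^ (alpha - be).
      by rewrite -powRrM mulVf ?gt_eqF// powRr1// ltW.
    by apply: gt0_ltr_powR; rewrite ?nnegrE ?(ltW X0).
  have -> : X w `^ alpha = X w `^ (alpha - be) * X w `^ be.
    by rewrite -powRD ?subrK// (gt_eqF X0) implybT.
  by rewrite ltr_pM2r ?powR_gt0.
apply: (@lt_le_trans _ _ (\int[P]_w Q w)).
  rewrite ExB//; last by apply: L1B => //; exact: L1Z.
  rewrite ExB//; last exact: L1Z.
  rewrite ExZ// ETgJ EUg EVJ EU EV.
  have -> : \int[P]_w (A (om w) `^ alpha) = 1 by rewrite /Rintegral EAalpha.
  have LEgJ : L * \int[P]_w \1_J (X w) <= \int[P]_w gJ (X w).
    rewrite -ExZ; last exact: LJ.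
    apply: le_Ex; [by apply: L1Z; exact: LJ|exact: LgJ|move=> w].
    rewrite /gJ mulrC indicE; case: (boolP (X w \in J)) => [|_]; last by rewrite !mul0r.
    by rewrite inE /J/= !mul1r; exact: cL.
  rewrite mul1r -(mulrA c) -(mulrA c C); apply: (mean_defect_gt0 _ _ _ _ _ L) => //.
  - exact: ltW.
  - by rewrite /L divfK// gt_eqF.
apply: Ex_ae_le => //; first exact/Ldefect/ltW.
apply: filterS2 hK pos_near => w hKw hw.
have /andP[l' _] := H_bounds c (X' w) (ltW c0).
have A0' := ltW (A0 (om w)).
have hX' : pos (X' w) `^ be <= (1 + del) * (A (om w) `^ be * g w) + C * `|B (om w)| `^ be.
  have AX0 : 0 <= A (om w) * pos (X w) by rewrite mulr_ge0.
  apply: (@le_trans _ _ ((A (om w) * pos (X w) + `|B (om w)|) `^ be)).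
    apply: ge0_ler_powR; rewrite ?nnegrE ?(ltW be0) ?addr_ge0//.
    by rewrite -lerBlDl; apply: (le_trans (ler_norm _)); exact: hw.
  apply: (le_trans (hC _ _ AX0 (normr_ge0 _))).
  by rewrite powRM.
rewrite /Q /gJ indicE; case: (boolP (X w \in J)) => [|/negP].
  rewrite inE /J/= => XJ.
  have -> : H c (X w) = pos (X w) `^ alpha - c * g w.
    by rewrite {1}/H {1}/pos max_r// subr_ge0 ltW.
  move: hKw l'; rewrite ler_norml => /andP[h1 _] l'.
  rewrite !mul1r mulr1 -/(g w) -expR_xi.
  exact: (pointwise_defect_ge _ _ _ _ _ _ _ _ _ _ _ _ _ _ (ltW c0) hX' l' h1).
rewrite inE /J/= => /negP; rewrite -leNgt => XJ.
have -> : H c (X w) = 0 by rewrite {1}/H {1}/pos max_l// subr_le0.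
by rewrite !mul0r !mulr0 !subr0 pos_ge0.
Qed.

Theorem asymptotically_linear_tail : exists C : R,
  mule (t `^ alpha)%:E (P [set w | t < X w]) @[t --> +oo] --> C%:E /\
  ((forall M : R, exists2 x, law_support P X x & M < x) -> 0 < C).
Proof.
set m := \int[P]_w (expR (xi w) * xi w).
have H0 x : H 0 x = pos x `^ alpha.
  by rewrite /H mul0r subr0 /pos max_r// powR_ge0.
exists (defect 0 / m); split.
  have lim : t `^ alpha * tail P (fun w => H 0 (X w)) (t `^ alpha) @[t --> +oo] -->
      defect 0 / m.
    apply: cvg_comp (renewal 0 (lexx 0)); apply/cvgryPge => M.
    pose N := Num.max 1 M `^ alpha^-1.
    apply: filterS (nbhs_pinfty_ge (num_real N)) => t Nt.
    apply: (@le_trans _ _ (N `^ alpha)).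
      rewrite -powRrM mulVf ?gt_eqF// powRr1 ?le_max ?ler01 ?lexx ?orbT//.
    by apply: ge0_ler_powR; rewrite ?nnegrE ?(ltW alpha0) ?powR_ge0// (le_trans _ Nt)// powR_ge0.
  apply: cvg_EFin.
    apply: nearW => t; rewrite fin_numM// fin_num_measure//.
    exact: measurable_tail.
  apply: cvg_trans lim; apply: near_eq_cvg.
  apply: filterS (nbhs_pinfty_gt (num_real 0)) => t t0 /=.
  rewrite -[P _]fineK; last by rewrite fin_num_measure//; exact: measurable_tail.
  rewrite -EFinM /=; congr (_ * fine (P _)); apply/seteqP; split => w /=; rewrite H0 => h.
    rewrite ltNge; apply/negP => Xt; move: h; rewrite ltNge => /negP; apply.
    apply: ge0_ler_powR; rewrite ?nnegrE ?(ltW alpha0) ?(ltW t0)//.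
    by rewrite ge_max (ltW t0).
  apply: gt0_ltr_powR; rewrite ?nnegrE ?(ltW t0)//.
  by rewrite lt_max h orbT.
move=> /defect_gt0[c c0 dc0].
apply: (@lt_le_trans _ _ (defect c / m)); first by rewrite divr_gt0.
apply: (ler_cvg_to (renewal c c0) (renewal 0 (lexx 0))).
apply: filterS (nbhs_pinfty_ge (num_real 0)) => M M0.
rewrite ler_wpM2l// -lee_fin !tailE; last 2 first.
- exact: mZ.
- exact: mZ.
apply: le_measure; rewrite ?inE; [exact/measurable_tail/mZ..|].
move=> w /= /lt_le_trans; apply; rewrite H0.
by have /andP[] := H_bounds c (X w) c0.
Qed.

End AsymptoticallyLinear.

Theorem theorem3p9
  (R : realType) (Theta : pseudoPMetricType R) (Theta_metric : hausdorff_space Theta)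
  (Psi : Theta -> R -> R)
  (Psi_meas : measurable_fun [set: (borelT Theta * R)%type]
                (fun p : (borelT Theta * R)%type => Psi p.1 p.2))
  (Psi_lip : forall th : Theta, lipschitz (Psi th))
  (Psi_cont : forall x : R, continuous (fun th : Theta => Psi th x))
  (dO : measure_display) (Om : measurableType dO) (P : probability Om R)
  (om : Om -> borelT Theta) (om_meas : measurable_fun [set: Om] om)
  (hlogL_pos : (\int[P]_w maxe (eln (lipconst (Psi (om w)))) 0 < +oo)%E)
  (hlogL : (\int[P]_w eln (lipconst (Psi (om w))) < 0)%E)
  (hPsi0 : (\int[P]_w (lnp `|Psi (om w) 0|)%:E < +oo)%E)
  (X : Om -> R) (X_meas : measurable_fun [set: Om] X)
  (X_indep : indep P om X)
  (X_stat : forall S : set R, measurable S ->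
     P (X @^-1` S) = P ((fun w => Psi (om w) (X w)) @^-1` S))
  (A B : borelT Theta -> R)
  (A_meas : measurable_fun [set: borelT Theta] A)
  (B_meas : measurable_fun [set: borelT Theta] B)
  (A_pos : forall th, 0 < A th)
  (hAB : {ae P, forall w, forall x, law_support P X x ->
      A (om w) * x - B (om w) <= Psi (om w) x <= A (om w) * x + B (om w)})
  (hlogA : (\int[P]_w (ln (A (om w)))%:E < 0)%E)
  (alpha : R) (alpha_pos : 0 < alpha)
  (hAalpha : (\int[P]_w (A (om w) `^ alpha)%:E = 1)%E)
  (hmom : (\int[P]_w ((`|B (om w)| `^ alpha + A (om w) `^ alpha * lnp (A (om w)))%:E)
            < +oo)%E)
  (hnonarith : ~ arithmetic_law P (fun w => ln (A (om w)))) :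
  exists C : R,
    mule (t `^ alpha)%:E (P [set w | t < X w]) @[t --> +oo] --> C%:E /\
    ((forall M : R, exists2 x, law_support P X x & M < x) -> 0 < C).
Proof.
have mX' : measurable_fun [set: Om] (fun w => Psi (om w) (X w)).
  have mp : measurable_fun [set: Om] (fun w => (om w, X w)) by exact: measurable_fun_pair.
  exact: (measurableT_comp Psi_meas mp).
apply: (asymptotically_linear_tail P om X _ A B om_meas X_meas mX' X_indep X_stat
  A_meas B_meas A_pos _ alpha alpha_pos hAalpha hmom hnonarith).
(* The affine bounds are assumed only on the support; almost surely [X w] lies there and may be
   substituted for [x]. *)
apply: filterS2 hAB (law_support_ae P X X_meas) => w lin suppX.
have /andP[lo up] := lin _ suppX; apply: le_trans (ler_norm _).
by rewrite ler_norml; apply/andP; split; lra.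
Qed.
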